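(* Let $(G_n)$, $G_n=(V_n,E_n)$, be a sequence of finite connected vertex transitive graphs satisfying the Transience Assumption (stated in the context). Let $\alpha\in(0,1)$ and $\ell\in\mathbf N$. There exist numbers $\delta_{r,\ell}\ge0$ ($r>0$) with $\delta_{r,\ell}\to0$ as $r\to\infty$ ($\ell$ fixed) such that the following holds. If $(x_n^i)$, $1\le i\le\ell$, is a family of sequences with $x_n^i\in V_n$ and $d(x_n^i,x_n^j)\ge r$ for every $n$ and $i\ne j$, then for all $n$ large enough $$(1-\delta_{r,\ell})\,|V_n|^{-\ell\alpha-\delta_{r,\ell}}\le\mathbf P\bigl[x_n^i\in\mathcal L(\alpha;G_n)\text{ for all }i\bigr]\le(1+\delta_{r,\ell})\,|V_n|^{-\ell\alpha+\delta_{r,\ell}}.$$ Moreover, if the maximal degree $\overline\Delta(G_n)\to\infty$ as $n\to\infty$, then the same two-sided bound holds with $r=1$ (i.e. assuming only that $x_n^1,\dots,x_n^\ell$ are distinct) and with $\delta_{r,\ell}$ replaced by a quantity $\delta_{1,\ell}=\delta_{1,\ell}(n)=o(1)$ as $n\to\infty$.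
   Context: For a finite connected graph $G=(V,E)$, $X$ is the lazy random walk on $G$: $p(x,x;G)=\tfrac12$ and $p(x,y;G)=\tfrac1{2\deg(x)}$ if $\{x,y\}\in E$; $p^t(x,y;G)$ is its $t$-step kernel and $\pi$ its stationary distribution. $\mathbf P$ is the law of $X$ started from stationarity. $\tau(x)$ is the first time $X$ hits $x$, $\tau_{\mathrm{cov}}(G)$ is the first time $X$ has visited every vertex, $T_{\mathrm{cov}}(G)=\mathbf E_\pi[\tau_{\mathrm{cov}}(G)]$, and $\mathcal L(\alpha;G)=\{x\in V:\tau(x)\ge\alpha T_{\mathrm{cov}}(G)\}$ is the set of $\alpha$-late points. $d(\cdot,\cdot)$ is graph distance, $d(x,A)=\min_{y\in A}d(x,y)$, $B(x,r)$ the ball of radius $r$ about $x$. Uniform mixing time: $T^U_{\mathrm{mix}}(G)=\min\{t\ge0:\max_{x,y\in V}|p^t(x,y;G)/\pi(y)-1|\le\frac14\}$. Green's function: $g(x,y;G)=\sum_{t=0}^{T^U_{\mathrm{mix}}(G)}p^t(x,y;G)$, and $g(x,A;G)=\sum_{y\in A}g(x,y;G)$. $(G_n)$ is uniformly locally transient with transience function $\rho:[0,\infty)\times[0,\infty)\to[0,\infty)$ if $g(x,A;G_n)\le\rho(d(x,A),\mathrm{diam}(A))$ for all $n$, $x\in V_n$, $A\subseteq V_n$, where $\rho(\cdot,s)$ is nonincreasing and $\lim_{r\to\infty}\rho(r,s)=0$ for each fixed $s$. Let $\overline\Delta(G)=\max_x\deg(x)$, $\underline\Delta(G)=\min_x\deg(x)$,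 $\Delta(G)=\overline\Delta(G)/\underline\Delta(G)$. Transience Assumption: $(G_n)$ is a uniformly locally transient sequence with $|V_n|\to\infty$, there is $\Delta_0>0$ with $\Delta(G_n)\le\Delta_0$ for all $n$, and for each $r>0$: (1) $\log|B(x,r)|=o(\log|V_n|)$ as $n\to\infty$ (uniformly in $x\in V_n$); (2) $T^U_{\mathrm{mix}}(G_n)\,\overline\Delta(G_n)^r=o(|V_n|)$ as $n\to\infty$. *)

(* Defs.v *)
From HB Require Import structures.
From mathcomp Require Import all_boot all_order all_algebra all_fingroup.
From mathcomp Require Import all_classical all_reals all_analysis.

Set Implicit Arguments.
Unset Strict Implicit.
Unset Printing Implicit Defensive.

Import Order.TTheory GRing.Theory Num.Theory.
Import numFieldNormedType.Exports.

Local Open Scope classical_set_scope.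
Local Open Scope ring_scope.

(* Least element of a set of naturals; 0 on the empty set. *)
Definition nat_min (A : set nat) : nat :=
  xget 0%N [set m | A m /\ forall k, A k -> (m <= k)%N].

Lemma nat_minP (A : set nat) : A !=set0 ->
  A (nat_min A) /\ forall k, A k -> (nat_min A <= k)%N.
Proof.
move=> [a Aa]; rewrite /nat_min; case: xgetP => [m _ //|noA].
have exA : exists k, `[< A k >] by exists a; apply/asboolP.
case: (ex_minnP exA) => m /asboolP Am mP.
by case: (noA m); split=> // k Ak; apply/mP/asboolP.
Qed.

Record sgraph := SGraph {
  vertex :> finType;
  adj : rel vertex;
  adj_sym : symmetric adj;
  adj_irr : irreflexive adj
}.

Section Graph.
Variable G : sgraph.
Implicit Types (x y : G) (A : {set G}).

Definition connected_graph : Prop :=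
  (0 < #|G|)%N /\ forall x y, connect (@adj G) x y.

Definition vertex_transitive : Prop :=
  forall x y, exists f : {perm G},
    (forall u v, adj (f u) (f v) = adj u v) /\ f x = y.

Definition deg x : nat := #|[set y | adj x y]%SET|.

Definition maxdeg : nat := \max_(x : G) deg x.

(* The neutral value [maxdeg] is immaterial, being at least every degree. *)
Definition mindeg : nat := \big[minn/maxdeg]_(x : G) deg x.

Definition dist x y : nat :=
  nat_min [set k | exists p : seq G,
    [/\ path (@adj G) x p, last x p = y & size p = k]].

Definition dist_set x A : nat := nat_min [set dist x y | y in [set` A]].

Definition diam A : nat := \max_(x in A) \max_(y in A) dist x y.

End Graph.

Section LazyWalk.
Variables (R : realType) (G : sgraph).
Implicit Types (x y : G) (A : {set G}) (mu : G -> R).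

Definition degratio : R := (maxdeg G)%:R / (mindeg G)%:R.

Definition ball_graph x (r : R) : {set G} :=
  [set y | (dist x y)%:R <= r]%SET.

(* On the one-vertex graph, which has no edge, the walk is constant. *)
Definition lazy_kernel x y : R :=
  if x == y then (if deg x == 0%N then 1 else 2^-1)
  else if adj x y then (2 * (deg x)%:R)^-1 else 0.

Fixpoint lazy_kernel_iter (t : nat) x y : R :=
  if t is t'.+1 then \sum_(z : G) lazy_kernel x z * lazy_kernel_iter t' z y
  else (x == y)%:R.

Definition is_stationary mu : Prop :=
  [/\ forall x, 0 <= mu x, \sum_(x : G) mu x = 1
    & forall y, \sum_(x : G) mu x * lazy_kernel x y = mu y].

(* [is_stationary] has exactly one solution when [G] is connected. *)
Definition stationary : G -> R := xget (fun=> 0) [set mu | is_stationary mu].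

(* The set is nonempty when [G] is connected, the walk being lazy. *)
Definition Tmix : nat :=
  nat_min [set t | forall x y,
    `|lazy_kernel_iter t x y / stationary y - 1| <= 4^-1].

Definition green x y : R := \sum_(0 <= t < Tmix.+1) lazy_kernel_iter t x y.

Definition green_set x A : R := \sum_(y in A) green x y.

Section Process.
Context {d : measure_display} {Omega : measurableType d}.
Variables (P : probability Omega R) (X : nat -> Omega -> G).

Definition stationary_lazy_walk : Prop :=
  (forall t x, measurable [set w | X t w = x]) /\
  (forall t (v : nat -> G),
     P [set w | forall s, (s <= t)%N -> X s w = v s] =
     (stationary (v 0%N) * \prod_(0 <= s < t) lazy_kernel (v s) (v s.+1))%:E).

(* Times take values in [\bar R]: the infimum is +oo if there is no visit. *)
Definition hitting_time x (w : Omega) : \bar R :=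
  ereal_inf [set t%:R%:E | t in [set t : nat | X t w = x]].

Definition cover_time (w : Omega) : \bar R :=
  ereal_inf [set t%:R%:E | t in
    [set t : nat | forall x, exists2 s, (s <= t)%N & X s w = x]].

Definition Tcov : \bar R := (\int[P]_w cover_time w)%E.

Definition late_points (alpha : R) (w : Omega) : set G :=
  [set x | (alpha%:E * Tcov <= hitting_time x w)%E].

End Process.
End LazyWalk.

Definition transience_function (R : realType) (rho : R -> R -> R) : Prop :=
  [/\ forall r s, 0 <= r -> 0 <= s -> 0 <= rho r s,
      forall s, 0 <= s ->
        forall r1 r2, 0 <= r1 -> r1 <= r2 -> rho r2 s <= rho r1 s
    & forall s, 0 <= s -> rho r s @[r --> +oo] --> (0 : R)].

Definition uniformly_locally_transient (R : realType) (G : nat -> sgraph)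
    (rho : R -> R -> R) : Prop :=
  transience_function rho /\
  forall n (x : G n) (A : {set G n}),
    green_set R x A <= rho (dist_set x A)%:R (diam A)%:R.

Definition transience_assumption (R : realType) (G : nat -> sgraph) : Prop :=
  [/\ exists rho : R -> R -> R, uniformly_locally_transient G rho,
      #|G n| @[n --> \oo] --> \oo,
      exists2 Delta0 : R, 0 < Delta0 & forall n, degratio R (G n) <= Delta0,
      forall r : R, 0 < r -> forall eps : R, 0 < eps ->
        \forall n \near \oo, forall x : G n,
          ln (#|ball_graph x r|%:R : R) <= eps * ln (#|G n|%:R : R)
    & forall r : R, 0 < r ->
        (fun n => (Tmix R (G n))%:R * (maxdeg (G n))%:R `^ r : R^o) =o_\oo
        (fun n => #|G n|%:R : R^o)].

Definition late_bounds (N l : nat) (R : realType) (alpha delta : R)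
    (p : \bar R) : Prop :=
  (((1 - delta) * N%:R `^ (- (l%:R * alpha) - delta))%:E <= p /\
   p <= ((1 + delta) * N%:R `^ (- (l%:R * alpha) + delta))%:E)%E.

(* Main.v *)
Require Import Defs.
From HB Require Import structures.
From mathcomp Require Import all_boot all_order all_algebra all_fingroup.
From mathcomp Require Import ring lra.
From mathcomp Require Import all_classical all_reals all_analysis.
From mathcomp Require Import measurable_realfun.

Set Implicit Arguments.
Unset Strict Implicit.
Unset Printing Implicit Defensive.

Import Order.TTheory GRing.Theory Num.Theory.
Import numFieldNormedType.Exports.

(* Write N for the number of vertices, M for a large multiple of the mixing
   time (still o(N)), and gamma for the expected number of visits to the
   starting point before time M.

   The hitting time of a set A of l well separated points is nearly exponential
   with mean N gamma / l.  From above: off A, the sum over A of the occupation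
   kernels [occ M] is, up to sign, a Lyapunov function whose drift is almost
   constant because the M-step kernel is almost uniform.  From below: a first
   moment bound over a window much longer than M and much shorter than N gamma,
   extended to all times by f(2t) >= f(t)^2, which is Cauchy-Schwarz for
   f(t) = P[A not hit by time t].

   The expected cover time is N gamma ln N (1 + o(1)), by a union bound from
   above and by Matthews' bound on a separated set of N^(1 - o(1)) vertices from
   below.  Hence l prescribed points are all alpha-late with probability
   exp (- l alpha ln N (1 + o(1))).

   When the degree D tends to infinity, distinct points already count as
   separated: the first jump from x is uniform over its D neighbours, on which
   the Green function has bounded sum. *)

(** The same [gamma] governs hitting and covering, so [N * gamma] cancels in the final exponent, and
    nothing is needed about [gamma] beyond [1 <= gamma].

    The obstacle is that the walk may be next to a point of the family, where Green's function is
    not small. Laziness settles this: powers of the kernel are positive semidefinite, so no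
    occupation exceeds the diagonal value [gamma], and it suffices that from each vertex all points
    of the family but one contribute little.

    The errors are tuned by [zeta], with [eta = zeta ^ 2]. The lower bound on survival uses about
    [ln N / zeta] windows. Each wastes at most [M <= eta * N] steps, which costs
    [(eta / zeta) * ln N = zeta * ln N] in the exponent up to a factor; each is hit with probability
    [q] of order [zeta], so the second-order part of [ln (1 - q)] costs another multiple of
    [zeta * ln N]. *)

Local Open Scope ring_scope.

(** * Lazy symmetric kernels and survival probabilities *)

Section KernelDefs.
Variables (R : realType) (V : finType) (p : V -> V -> R).
Implicit Types (x y : V) (A W : {set V}) (F : V -> {set V} -> R).

Fixpoint kpow (t : nat) x y : R :=
  if t is t'.+1 then \sum_z p x z * kpow t' z y else (x == y)%:R.

Definition occ (M : nat) x y : R := \sum_(t < M) kpow t x y.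

(** Probability of avoiding [A] from [x] at times 0 to [t], both ends included, whereas [occ M]
    counts times below [M] only. *)
Fixpoint surv A (t : nat) x : R :=
  if t is t'.+1 then (x \notin A)%:R * \sum_z p x z * surv A t' z
  else (x \notin A)%:R.

Definition msurv A t : R := #|V|%:R^-1 * \sum_x surv A t x.

(* One step of the walk together with the set of vertices visited so far. *)
Definition kstep F x W : R := \sum_z p x z * F z (z |: W).

(** Expectation of [F] at the position and visited set at time [t], from the uniform law. Backward
    iteration keeps the cover estimates free of measure theory; [visited_walk_exp] makes the
    link. *)
Definition walk_exp t F : R := #|V|%:R^-1 * \sum_x iter t kstep F x [set x].

(** A vertex transitive graph is regular, so its lazy walk is symmetric and the uniform law is
    stationary. *)
Definition lazy_symmetric : Prop :=
  [/\ forall x y, 0 <= p x y, forall x y, p x y = p y x,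
      forall x, \sum_y p x y = 1 & forall x, 2^-1 <= p x x].

End KernelDefs.

Section Kernel.
Variables (R : realType) (V : finType) (p : V -> V -> R).
Hypothesis pP : lazy_symmetric p.
Implicit Types (x y z : V) (A W S : {set V}) (F : V -> {set V} -> R).

Let p_ge0 x y : 0 <= p x y. Proof. by case: pP. Qed.
Let p_sym x y : p x y = p y x. Proof. by case: pP. Qed.
Let p_sum x : \sum_y p x y = 1. Proof. by case: pP. Qed.
Let p_lazy x : 2^-1 <= p x x. Proof. by case: pP. Qed.

Local Notation N := (#|V|%:R : R).

Lemma kpow_ge0 t x y : 0 <= kpow p t x y.
Proof.
elim: t x y => [|t IH] x y /=; first exact: ler0n.
by apply: sumr_ge0 => z _; rewrite mulr_ge0.
Qed.

Lemma sum_delta (f : V -> R) x : \sum_z (x == z)%:R * f z = f x.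
Proof.
rewrite (bigD1 x) //= eqxx mul1r big1 ?addr0 // => z /negPf.
by rewrite eq_sym => ->; rewrite mul0r.
Qed.

Lemma kpowD s t x y : kpow p (s + t) x y = \sum_z kpow p s x z * kpow p t z y.
Proof.
elim: s x => [|s IH] x; first by rewrite sum_delta.
rewrite addSn /=; under eq_bigr do rewrite IH mulr_sumr.
rewrite exchange_big /=; apply: eq_bigr => z _.
by rewrite mulr_suml; apply: eq_bigr => w _; rewrite mulrA.
Qed.

Lemma kpow1 x y : kpow p 1 x y = p x y.
Proof.
rewrite /=; under eq_bigr do rewrite eq_sym mulrC.
by rewrite sum_delta.
Qed.

Lemma kpowSr t x y : kpow p t.+1 x y = \sum_z kpow p t x z * p z y.
Proof. by rewrite -addn1 kpowD; under eq_bigr do rewrite kpow1. Qed.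

Lemma kpow_sym t x y : kpow p t x y = kpow p t y x.
Proof.
elim: t x y => [|t IH] x y; first by rewrite /= eq_sym.
rewrite kpowSr /=; apply: eq_bigr => z _.
by rewrite IH p_sym mulrC.
Qed.

Lemma kpow_sum t x : \sum_y kpow p t x y = 1.
Proof.
elim: t x => [|t IH] x.
  by have := sum_delta (fun=> 1) x; under eq_bigr do rewrite mulr1.
rewrite /= exchange_big /=; under eq_bigr do rewrite -mulr_sumr IH mulr1.
exact: p_sum.
Qed.

Lemma kpow_suml t y : \sum_x kpow p t x y = 1.
Proof. by under eq_bigr do rewrite kpow_sym; exact: kpow_sum. Qed.

Lemma kpow_le1 t x y : kpow p t x y <= 1.
Proof.
rewrite -(kpow_sum t x) (bigD1 y) //= lerDl.
by apply: sumr_ge0 => z _; exact: kpow_ge0.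
Qed.

Lemma card_gt0R x : 0 < N.
Proof. by rewrite ltr0n; apply/card_gt0P; exists x. Qed.

(** Expanding [(g x + g y) ^ 2] off the diagonal shows that the off-diagonal part is at least minus
    the form with weights [1 - p x x], and [1 - p x x <= p x x]. *)
Lemma lazy_form_ge0 (g : V -> R) : 0 <= \sum_x \sum_y p x y * (g x * g y).
Proof.
have h : 0 <= \sum_x \sum_(y | y != x) p x y * (g x + g y) ^+ 2.
  apply: sumr_ge0 => x _; apply: sumr_ge0 => y _.
  by rewrite mulr_ge0 // sqr_ge0.
have e1 : \sum_x \sum_(y | y != x) p x y * g x ^+ 2 =
    \sum_x (1 - p x x) * g x ^+ 2.
  apply: eq_bigr => x _; rewrite -mulr_suml; congr (_ * _).
  by have := p_sum x; rewrite (bigD1 x) //=; lra.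
have e2 : \sum_x \sum_(y | y != x) p x y * g y ^+ 2 =
    \sum_x (1 - p x x) * g x ^+ 2.
  rewrite -e1 (exchange_big_dep xpredT) //=; apply: eq_bigr => x _.
  by apply: eq_big => y; rewrite 1?eq_sym // p_sym.
have e3 : \sum_x \sum_y p x y * (g x * g y) =
   \sum_x p x x * g x ^+ 2 + \sum_x \sum_(y | y != x) p x y * (g x * g y).
  by rewrite -big_split /=; apply: eq_bigr => x _; rewrite (bigD1 x).
have e4 : \sum_x \sum_(y | y != x) p x y * (g x + g y) ^+ 2 =
   2 * \sum_x (1 - p x x) * g x ^+ 2 +
   2 * \sum_x \sum_(y | y != x) p x y * (g x * g y).
  rewrite mulr2n !mulrDl !mul1r -{1}e1 -e2 -!big_split /=.
  apply: eq_bigr => x _; rewrite -!big_split /=; apply: eq_bigr => y _; ring.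
have h5 : \sum_x (1 - p x x) * g x ^+ 2 <= \sum_x p x x * g x ^+ 2.
  apply: ler_sum => x _; apply: ler_wpM2r; first exact: sqr_ge0.
  have := p_lazy x; lra.
rewrite e3; rewrite e4 in h; lra.
Qed.

(** Positive semidefiniteness of [kpow t], tested on the difference of two point masses: an even
    power is a Gram matrix, an odd one is a Gram matrix with [p] in the middle. *)
Lemma kpow_le_diag t x y : kpow p t x y <= 2^-1 * (kpow p t x x + kpow p t y y).
Proof.
suff : 0 <= kpow p t x x - kpow p t x y *+ 2 + kpow p t y y by lra.
pose g s z : R := kpow p s x z - kpow p s y z.
have e : kpow p t x x - kpow p t x y *+ 2 + kpow p t y y =
   kpow p t x x - kpow p t x y - kpow p t y x + kpow p t y y.
  by rewrite (kpow_sym t y x); ring.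
have [a [ta|ta]] : exists a, t = (a + a)%N \/ t = (a + 1 + a)%N.
  exists t./2; rewrite -{1 4}(odd_double_half t) -addnn.
  by case: (odd t); [right|left]; rewrite ?add0n // addn1 add1n addSn.
- have -> : kpow p t x x - kpow p t x y *+ 2 + kpow p t y y = \sum_z g a z ^+ 2.
    rewrite e ta !kpowD -!sumrB -big_split /=; apply: eq_bigr => z _.
    rewrite /g !(kpow_sym a z); ring.
  by apply: sumr_ge0 => z _; exact: sqr_ge0.
- have d u v : kpow p t u v = \sum_z \sum_w p z w * (kpow p a u z * kpow p a v w).
    rewrite ta -addnA kpowD; apply: eq_bigr => z _.
    rewrite kpowD mulr_sumr; apply: eq_bigr => w _.
    by rewrite kpow1 (kpow_sym a w); ring.
  have -> : kpow p t x x - kpow p t x y *+ 2 + kpow p t y y =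
      \sum_z \sum_w p z w * (g a z * g a w).
    rewrite e !d -!sumrB -big_split /=; apply: eq_bigr => z _.
    rewrite -!sumrB -big_split /=; apply: eq_bigr => w _; rewrite /g; ring.
  exact: lazy_form_ge0.
Qed.

Lemma occ_ge0 M x y : 0 <= occ p M x y.
Proof. by apply: sumr_ge0 => t _; exact: kpow_ge0. Qed.

Lemma occ_sym M x y : occ p M x y = occ p M y x.
Proof. by apply: eq_bigr => t _; exact: kpow_sym. Qed.

(** A step shifts the window of times: time 0 is lost and time [M] gained. This is the source of
    every drift computation below. *)
Lemma occ_step M x y :
  \sum_z p x z * occ p M z y = occ p M x y - (x == y)%:R + kpow p M x y.
Proof.
under eq_bigr do rewrite mulr_sumr.
rewrite exchange_big /=.
have -> : \sum_(t < M) \sum_z p x z * kpow p t z y = \sum_(t < M) kpow p t.+1 x y.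
  by [].
have : \sum_(t < M.+1) kpow p t x y = occ p M x y + kpow p M x y.
  by rewrite big_ord_recr.
rewrite big_ord_recl -[kpow p ord0 x y]/((x == y)%:R); move: (occ p M x y) => o.
by lra.
Qed.

Lemma occ_suml M y : \sum_x occ p M x y = M%:R.
Proof.
rewrite exchange_big /=; under eq_bigr do rewrite kpow_suml.
by rewrite sumr_const card_ord.
Qed.

Lemma surv_ge0 A t x : 0 <= surv p A t x.
Proof.
elim: t x => [|t IH] x /=; first exact: ler0n.
by rewrite mulr_ge0 // sumr_ge0 // => z _; rewrite mulr_ge0.
Qed.

Lemma surv_in A t x : x \in A -> surv p A t x = 0.
Proof. by move=> xA; case: t => [|t] /=; rewrite xA ?mul0r. Qed.

Lemma surv_notin A t x : x \notin A ->
  surv p A t.+1 x = \sum_z p x z * surv p A t z.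
Proof. by move=> xA /=; rewrite xA mul1r. Qed.

(* If [u x] bounds the expected hitting time of [A] from [x] and [c u <= K],
   one step contracts the function [1 + c u] off [A] by [exp (- c / (1 + K))].
   Such a [u] is an affine function of the sum over [A] of [occ p M x]. *)
Lemma msurv_le A M (eta C K : R) t :
  (0 < #|A|)%N -> 0 < eta < 1 -> 0 < C -> 0 < K ->
  (forall x y, (1 - eta) / N <= kpow p M x y) ->
  (forall x, \sum_(y in A) occ p M x y <= C) ->
  msurv p A t <=
    (1 + K) * expR (- (t%:R * (K / (1 + K) * (#|A|%:R * (1 - eta) / (N * C))))).
Proof.
move=> A0 eta01 C0 K0 mixM occA.
have [x0 _] : exists x, x \in A by apply/card_gt0P.
have N0 : 0 < N := card_gt0R x0.
have l0 : 0 < #|A|%:R :> R by rewrite ltr0n.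
(* [a] makes [a * (C - \sum occ)] decrease by at least one per step off [A]; [c] then scales its
   range into [[0, K]]. *)
pose a : R := N / (#|A|%:R * (1 - eta)).
have a0 : 0 < a by rewrite divr_gt0 // mulr_gt0 //; lra.
pose c := K / (a * C).
have c0 : 0 < c by rewrite divr_gt0 // mulr_gt0.
have caC : c * (a * C) = K by rewrite /c; field; rewrite !gt_eqF.
pose e := expR (- (c / (1 + K))).
pose w x := 1 + c * (a * (C - \sum_(y in A) occ p M x y)).
have w1 x : 1 <= w x.
  by rewrite lerDl mulr_ge0 ?(ltW c0) // mulr_ge0 ?(ltW a0) // subr_ge0.
have wK x : w x <= 1 + K.
  rewrite /w mulrBr mulrBr caC lerD2l lerBlDr lerDl.
  rewrite mulr_ge0 ?(ltW c0) // mulr_ge0 ?(ltW a0) // sumr_ge0 // => y _.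
  exact: occ_ge0.
have Pw x : x \notin A -> \sum_z p x z * w z <= w x - c.
  move=> xA.
  have -> : \sum_z p x z * w z = w x - c * a * \sum_(y in A) kpow p M x y.
    have pw z : p x z * w z = p x z * (1 + c * a * C) -
        c * a * \sum_(y in A) p x z * occ p M z y.
      by rewrite -mulr_sumr /w; ring.
    under eq_bigr do rewrite pw.
    rewrite sumrB -mulr_suml p_sum -mulr_sumr exchange_big /=.
    have -> : \sum_(y in A) \sum_z p x z * occ p M z y =
        \sum_(y in A) (occ p M x y + kpow p M x y).
      apply: eq_bigr => y yA; rewrite occ_step.
      suff -> : (x == y) = false by rewrite subr0.
      by apply: contraNF xA => /eqP->.
    rewrite big_split /= /w; ring.
  rewrite lerD2l lerN2 -{1}(mulr1 c) -mulrA ler_wpM2l ?(ltW c0) //.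
  have HA : #|A|%:R * ((1 - eta) / N) <= \sum_(y in A) kpow p M x y.
    rewrite mulr_natl -sumr_const; apply: ler_sum => y _; exact: mixM.
  apply: le_trans (_ : a * (#|A|%:R * ((1 - eta) / N)) <= _); last first.
    by rewrite ler_wpM2l // ltW.
  rewrite le_eqVlt; apply/orP; left; apply/eqP; rewrite /a; field.
  by rewrite !gt_eqF //; lra.
have e_w x : w x - c <= e * w x.
  have : c / (1 + K) * w x <= c / (1 + K) * (1 + K).
    by rewrite ler_wpM2l // divr_ge0 ?ltW //; lra.
  rewrite divfK; last by rewrite gt_eqF //; lra.
  have : (1 + - (c / (1 + K))) * w x <= e * w x.
    by rewrite ler_wpM2r ?expR_ge1Dx // (le_trans _ (w1 x)).
  lra.
have surv_w s x : surv p A s x <= e ^+ s * w x.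
  elim: s x => [|s IH] x.
    by rewrite expr0 mul1r (le_trans _ (w1 x)) //= lern1 leq_b1.
  have [xA|xA] := boolP (x \in A).
    rewrite surv_in // mulr_ge0 ?exprn_ge0 ?expR_ge0 //.
    by rewrite (le_trans _ (w1 x)).
  rewrite surv_notin // exprSr -mulrA.
  apply: le_trans (_ : e ^+ s * \sum_z p x z * w z <= _); last first.
    rewrite ler_wpM2l ?exprn_ge0 ?expR_ge0 //.
    exact: le_trans (Pw _ xA) (e_w x).
  rewrite mulr_sumr; apply: ler_sum => z _.
  by rewrite mulrCA ler_wpM2l.
have e_t : e ^+ t =
    expR (- (t%:R * (K / (1 + K) * (#|A|%:R * (1 - eta) / (N * C))))).
  rewrite -expRM_natl; congr expR; rewrite mulrN; congr (- (_ * _)).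
  rewrite /c /a; field; rewrite !gt_eqF //; lra.
rewrite -e_t /msurv mulrC ler_pdivrMr //.
apply: le_trans (_ : \sum_(x : V) ((1 + K) * e ^+ t) <= _).
  apply: ler_sum => x _; apply: le_trans (surv_w t x) _.
  by rewrite mulrC ler_wpM2r // exprn_ge0 // expR_ge0.
by rewrite sumr_const -[X in X <= _]mulr_natr.
Qed.

End Kernel.

(** * Lower bounds on survival: first moment and Cauchy-Schwarz *)

Section SurvivalBounds.
Variables (R : realType) (V : finType) (p : V -> V -> R).
Hypothesis pP : lazy_symmetric p.
Implicit Types (x y z : V) (A W S : {set V}) (F : V -> {set V} -> R).

Let p_ge0 x y : 0 <= p x y. Proof. by case: pP. Qed.
Let p_sym x y : p x y = p y x. Proof. by case: pP. Qed.
Let p_sum x : \sum_y p x y = 1. Proof. by case: pP. Qed.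

Local Notation N := (#|V|%:R : R).

(* A path hitting [A] before time [t] is expected to spend time at least
   [gamma] in [A] before time [M + t]. *)
Lemma msurv_ge A M gamma t : (0 < #|V|)%N -> 0 < gamma ->
  (forall y, y \in A -> gamma <= occ p M y y) ->
  1 - #|A|%:R * (M + t)%:R / (N * gamma) <= msurv p A t.
Proof.
move=> V0 g0 occA.
have occ0 s x B : 0 <= \sum_(y in B) occ p s x y.
  by apply: sumr_ge0 => y _; exact: occ_ge0.
have hA s x : x \in A -> 1 - gamma^-1 * \sum_(y in A) occ p (M + s) x y <= 0.
  move=> xA; rewrite subr_le0 -(mulVf (lt0r_neq0 g0)).
  rewrite ler_wpM2l ?invr_ge0 ?(ltW g0) // (bigD1 x) //=.
  apply: le_trans (occA _ xA) _.
  rewrite /occ big_split_ord /= -addrA lerDl addr_ge0 //.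
    by apply: sumr_ge0 => i _; exact: kpow_ge0.
  by apply: sumr_ge0 => i _; exact: occ_ge0.
(* Off [A] the time-0 term of the occupation vanishes, so one step turns the occupation before
   [M + s] into the one before [M + s + 1]. *)
have h s x : 1 - gamma^-1 * \sum_(y in A) occ p (M + s) x y <= surv p A s x.
  elim: s x => [|s IH] x; have [xA|xA] := boolP (x \in A).
  - by rewrite surv_in // hA.
  - by rewrite /= xA gerBl mulr_ge0 // invr_ge0 ltW.
  - by rewrite surv_in // hA.
  rewrite surv_notin //.
  apply: le_trans (_ : \sum_z p x z *
      (1 - gamma^-1 * \sum_(y in A) occ p (M + s) z y) <= _); last first.
    by apply: ler_sum => z _; rewrite ler_wpM2l.
  under [leRHS]eq_bigr do rewrite mulrBr mulr1 mulrCA mulr_sumr.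
  rewrite sumrB p_sum -mulr_sumr lerD2l lerN2 /=.
  rewrite ler_wpM2l ?invr_ge0 ?(ltW g0) // [leLHS]exchange_big /=.
  apply: ler_sum => y yA.
  rewrite occ_step // addnS /occ big_ord_recr /=.
  suff -> : (x == y) = false by rewrite subr0.
  by apply: contraNF xA => /eqP->.
have N0 : 0 < N by rewrite ltr0n.
rewrite /msurv [leRHS]mulrC ler_pdivlMr //.
apply: le_trans (_ : \sum_x
    (1 - gamma^-1 * \sum_(y in A) occ p (M + t) x y) <= _); last exact: ler_sum.
rewrite sumrB sumr_const -mulr_sumr exchange_big /=.
rewrite (eq_bigr (fun=> (M + t)%:R)); last by move=> y _; rewrite occ_suml.
rewrite sumr_const -(mulr_natl (M + t)%:R) mulrBl mul1r lerD2l lerN2.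
by rewrite le_eqVlt; apply/orP; left; apply/eqP; field; rewrite !gt_eqF.
Qed.

(** The kernel killed on [A] is symmetric, so a step can be moved from one factor to the other. *)
Lemma surv_form A s t :
  \sum_x surv p A s.+1 x * surv p A t x = \sum_x surv p A s x * surv p A t.+1 x.
Proof.
have e u v : \sum_x surv p A u.+1 x * surv p A v x =
    \sum_x \sum_z p x z * (surv p A u z * surv p A v x).
  apply: eq_bigr => x _; have [xA|xA] := boolP (x \in A).
    rewrite !surv_in // mul0r big1 // => z _.
    by rewrite !mulr0.
  by rewrite surv_notin // mulr_suml; apply: eq_bigr => z _; rewrite mulrA.
rewrite e [RHS](eq_bigr (fun x => surv p A t.+1 x * surv p A s x)); last first.
  by move=> x _; rewrite mulrC.
rewrite e exchange_big /=; apply: eq_bigr => x _; apply: eq_bigr => z _.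
by rewrite p_sym (mulrC (surv p A s x)).
Qed.

Lemma surv_dup A t : \sum_x surv p A (t + t) x = \sum_x surv p A t x ^+ 2.
Proof.
have h s u : \sum_x surv p A (s + u) x = \sum_x surv p A s x * surv p A u x.
  elim: s u => [|s IH] u.
    apply: eq_bigr => x _; case: (boolP (x \in A)) => xA.
      by rewrite !surv_in ?mul0r.
    by rewrite /= xA mul1r.
  by rewrite addSnnS IH -surv_form.
by rewrite h; apply: eq_bigr => x _; rewrite expr2.
Qed.

Lemma msurv_dup A t : (0 < #|V|)%N -> msurv p A t ^+ 2 <= msurv p A (t + t).
Proof.
move=> V0; have N0 : 0 < N by rewrite ltr0n.
rewrite /msurv surv_dup; set m := N^-1 * _.
(* Cauchy-Schwarz in the form of a nonnegative variance. *)
have : 0 <= \sum_x (surv p A t x - m) ^+ 2.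
  by apply: sumr_ge0 => x _; exact: sqr_ge0.
have -> : \sum_x (surv p A t x - m) ^+ 2 =
   \sum_x (surv p A t x ^+ 2) - 2 * m * \sum_x surv p A t x + N * m ^+ 2.
  under eq_bigr do rewrite sqrrB -mulr_natl mulrA (mulrC _ m).
  rewrite big_split sumrB /= -mulr_sumr sumr_const.
  rewrite -[m ^+ 2 *+ _]mulr_natl; congr (_ - _ + _).
  by rewrite !mulr_sumr; apply: eq_bigr => i _; ring.
have -> : \sum_x surv p A t x = N * m by rewrite /m mulVKf // gt_eqF.
move=> h; rewrite [leRHS]mulrC ler_pdivlMr //; lra.
Qed.

Lemma msurv_ge0 A t : 0 <= msurv p A t.
Proof.
by rewrite mulr_ge0 ?invr_ge0 ?ler0n // sumr_ge0 // => x _; exact: surv_ge0.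
Qed.

Lemma msurv_exp2 A s j : (0 < #|V|)%N ->
  msurv p A s ^+ (2 ^ j) <= msurv p A (2 ^ j * s).
Proof.
move=> V0; elim: j => [|j IH]; first by rewrite expr1 mul1n.
rewrite expnS [X in _ ^+ X]mulnC exprM.
apply: le_trans (_ : msurv p A (2 ^ j * s) ^+ 2 <= _).
  by rewrite lerXn2r // ?nnegrE ?exprn_ge0 ?msurv_ge0.
by apply: le_trans (msurv_dup _ _ V0) _; rewrite -mulnA mul2n addnn.
Qed.

Lemma surv_decr A t x : surv p A t.+1 x <= surv p A t x.
Proof.
elim: t x => [|t IH] x; have [xA|xA] := boolP (x \in A);
  try by rewrite !surv_in.
  rewrite surv_notin //= xA; apply: le_trans (_ : \sum_z p x z <= _);
    last by rewrite p_sum.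
  apply: ler_sum => z _.
  by rewrite ler_piMr //; case: (z \notin A); rewrite ?lexx ?ler01.
by rewrite !surv_notin //; apply: ler_sum => z _; rewrite ler_wpM2l.
Qed.

Lemma msurv_decr A s t : (s <= t)%N -> msurv p A t <= msurv p A s.
Proof.
move=> st; rewrite ler_wpM2l ?invr_ge0 ?ler0n //; apply: ler_sum => x _.
move: st; elim: t => [|t IH]; first by rewrite leqn0 => /eqP->.
rewrite leq_eqVlt => /predU1P[->//|]; rewrite ltnS => /IH.
exact: le_trans (surv_decr _ _ _).
Qed.

End SurvivalBounds.

(** * The walk with its visited set; Matthews' bound *)

Section Visited.
Variables (R : realType) (V : finType) (p : V -> V -> R).
Hypothesis pP : lazy_symmetric p.
Implicit Types (x y z : V) (A W S : {set V}) (F : V -> {set V} -> R).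

Let p_ge0 x y : 0 <= p x y. Proof. by case: pP. Qed.
Let p_sum x : \sum_y p x y = 1. Proof. by case: pP. Qed.

Local Notation N := (#|V|%:R : R).

Lemma walk_expS t F : walk_exp p t.+1 F = walk_exp p t (kstep p F).
Proof. by rewrite /walk_exp; under eq_bigr do rewrite iterSr. Qed.

Lemma kstep_le F1 F2 : (forall x W, x \in W -> F1 x W <= F2 x W) ->
  forall x W, x \in W -> kstep p F1 x W <= kstep p F2 x W.
Proof.
move=> F12 x W xW; apply: ler_sum => z _.
by rewrite ler_wpM2l // F12 // setU11.
Qed.

Lemma iter_kstep_le t F1 F2 : (forall x W, x \in W -> F1 x W <= F2 x W) ->
  forall x W, x \in W -> iter t (kstep p) F1 x W <= iter t (kstep p) F2 x W.
Proof. by move=> F12; elim: t => [//|t IH] x W; apply: kstep_le. Qed.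

Lemma walk_exp_le t F1 F2 : (forall x W, x \in W -> F1 x W <= F2 x W) ->
  walk_exp p t F1 <= walk_exp p t F2.
Proof.
move=> F12; rewrite ler_wpM2l ?invr_ge0 ?ler0n //; apply: ler_sum => x _.
by apply: iter_kstep_le; rewrite ?set11.
Qed.

Lemma kstep_sum I (r : seq I) (F : I -> V -> {set V} -> R) x W :
  kstep p (fun y U => \sum_(i <- r) F i y U) x W = \sum_(i <- r) kstep p (F i) x W.
Proof.
rewrite /kstep [RHS]exchange_big /=.
by apply: eq_bigr => z _; rewrite mulr_sumr.
Qed.

Lemma walk_exp_sum I (r : seq I) (F : I -> V -> {set V} -> R) t :
  walk_exp p t (fun x W => \sum_(i <- r) F i x W) =
  \sum_(i <- r) walk_exp p t (F i).
Proof.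
elim: t F => [|t IH] F.
  by rewrite /walk_exp /= exchange_big mulr_sumr.
rewrite walk_expS; under [RHS]eq_bigr do rewrite walk_expS.
rewrite -IH; congr walk_exp; apply/funext => x; apply/funext => W.
exact: kstep_sum.
Qed.

Lemma walk_expZ c F t :
  walk_exp p t (fun x W => c * F x W) = c * walk_exp p t F.
Proof.
elim: t F => [|t IH] F.
  by rewrite /walk_exp /= -mulr_sumr mulrCA.
rewrite !walk_expS -IH; congr walk_exp; apply/funext => x; apply/funext => W.
by rewrite /kstep mulr_sumr; apply: eq_bigr => z _; rewrite mulrCA.
Qed.

(** Once the visited set meets [A] it does so forever, so the indicator factors out of the
    iteration. The invariant [x \in W] makes disjointness force [x \notin A]. *)
Lemma walk_exp_avoid A t :
  walk_exp p t (fun x W => [disjoint W & A]%:R) = msurv p A t.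
Proof.
have dU x W : [disjoint x |: W & A] = (x \notin A) && [disjoint W & A].
  by rewrite -!finset.setI_eq0 finset.setIUl finset.setU_eq0 !finset.setI_eq0 disjoints1.
have h x W : x \in W ->
    iter t (kstep p) (fun x W => [disjoint W & A]%:R) x W =
    [disjoint W & A]%:R * surv p A t x.
  elim: t x W => [|t IH] x W xW /=.
    have [WA|WA] := boolP [disjoint W & A]; last by rewrite mul0r.
    by rewrite mul1r (disjointFr WA).
  have [WA|WA] := boolP [disjoint W & A].
    rewrite (disjointFr WA xW) !mul1r; apply: eq_bigr => z _.
    rewrite IH ?setU11 // dU WA andbT.
    by case: (boolP (z \in A)) => zA; rewrite ?mul1r // surv_in // mulr0.
  rewrite mul0r /kstep big1 // => z _.
  by rewrite IH ?setU11 // dU (negPf WA) andbF mul0r mulr0.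
rewrite /walk_exp; congr (_ * _); apply: eq_bigr => x _.
rewrite h ?set11 // disjoints1; case: (boolP (x \in A)) => xA.
  by rewrite surv_in ?mulr0.
by rewrite mul1r.
Qed.

Definition uncovered x W : R := (W != [set: V]%SET)%:R.

Lemma uncovered_le t : walk_exp p t uncovered <= \sum_y msurv p [set y] t.
Proof.
under eq_bigr do rewrite -walk_exp_avoid.
rewrite -walk_exp_sum; apply: walk_exp_le => x W _; rewrite /uncovered.
have [_|WT] := eqVneq W [set: V]%SET; first by apply: sumr_ge0 => y _; exact: ler0n.
have [y yW] : exists y, y \notin W.
  apply/existsP; rewrite -negb_forall; apply: contra WT => /forallP h.
  by apply/eqP/finset.setP => y; rewrite h inE.
rewrite (bigD1 y) //= disjoint_sym disjoints1 yW lerDl.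
by apply: sumr_ge0 => z _; exact: ler0n.
Qed.

Definition harmonic_sum (n : nat) : R := \sum_(i < n) i.+1%:R^-1.

(* Matthews' lower bound.  With [u] unvisited points of [S] left, the expected
   remaining time to cover [S] from [x] is at least
   [m H_u - (N' / u) \sum_y occ p M x y], the sum being over these points:
   away from them the potential drifts by at most one per step, because
   [kpow p M] is almost uniform, and it cannot exceed its next value at the visit
   of a new point, because [occ p M] is small off the diagonal. *)
Definition matthews (m N' : R) M S x W : R :=
  m * harmonic_sum #|S :\: W| -
  N' / #|S :\: W|%:R * \sum_(y in S :\: W) occ p M x y.

Lemma matthews_step (eta gamma : R) M S :
  (0 < #|V|)%N -> 0 < eta ->
  (forall x y, kpow p M x y <= (1 + eta) / N) ->
  (forall y, y \in S -> gamma <= occ p M y y) ->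
  (forall x y, x \in S -> y \in S -> x != y -> occ p M x y <= eta) ->
  let f := matthews (N / (1 + eta) * (gamma - eta)) (N / (1 + eta)) M S in
  forall x W, x \in W -> f x W - uncovered x W <= kstep p f x W.
Proof.
move=> V0 eta0 mixM occD occO f x W xW.
have N0 : 0 < N by rewrite ltr0n.
(* [N'] makes the drift at most one: [N' / u] times [u] terms of at most [(1 + eta) / N]. *)
set N' := N / (1 + eta); set m := N' * (gamma - eta).
have N'0 : 0 < N' by rewrite divr_gt0 //; lra.
have N'k k : 0 <= N' / k%:R by apply: divr_ge0; [exact: ltW|exact: ler0n].
set U := S :\: W; set u := #|U|.
(* Once [S] is covered, the inverse of 0 is 0 and the potential stays 0. *)
have [u0|u0] := posnP u.
  have fz z W' : S :\: W' = finset.set0 -> f z W' = 0.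
    by move=> e; rewrite /f /matthews e cards0 /harmonic_sum big_ord0 big_set0
      !mulr0 subr0.
  have U0 : U = finset.set0 by apply/eqP; rewrite -cards_eq0 -/u u0.
  rewrite fz // /kstep big1; last first.
    move=> z _; rewrite fz ?mulr0 //; apply/eqP; rewrite -finset.subset0 -U0.
    by rewrite finset.setDS // finset.subsetUr.
  by rewrite sub0r oppr_le0 ler0n.
have WT : uncovered x W = 1.
  rewrite /uncovered; suff -> : W != [set: V]%SET by [].
  by apply: contraTneq u0 => WT; rewrite /u /U WT finset.setDT cards0.
have u0R : 0 < u%:R :> R by rewrite ltr0n.
(* The potential with the set of unvisited points frozen: it carries the drift, and updating the set
   can only increase it. *)
pose g z := m * harmonic_sum u - N' / u%:R * \sum_(y in U) occ p M z y.
have fg z : g z <= f z (z |: W).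
  have UzW : S :\: (z |: W) = U :\ z by rewrite finset.setUC finset.setDDl.
  rewrite /f /matthews UzW.
  have [zU|zU] := boolP (z \in U); last first.
    suff -> : U :\ z = U by [].
    by apply/finset.setDidPl; rewrite disjoint_sym disjoints1.
  have zS : z \in S by move: zU; rewrite inE => /andP[].
  have cu : u = #|U :\ z|.+1 by rewrite /u (cardsD1 z) zU.
  move: cu; set v := #|U :\ z| => cu.
  set s := \sum_(y in U :\ z) _.
  have sE : \sum_(y in U) occ p M z y = occ p M z z + s.
    by rewrite (big_setD1 z).
  have s0 : 0 <= s by apply: sumr_ge0 => y _; exact: occ_ge0.
  have sv : s <= v%:R * eta.
    rewrite mulr_natl -sumr_const; apply: ler_sum => y.
    rewrite !inE => /and3P[yz yW yS].
    by rewrite occO // eq_sym.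
  rewrite /g sE -/N' -/m [in harmonic_sum u]cu /harmonic_sum big_ord_recr /=.
  rewrite -/(harmonic_sum v) -cu; set H := harmonic_sum v.
  have od : gamma <= occ p M z z by exact: occD.
  (* Deleting [z] raises the weight from [N' / u] to [N' / v], at the extra cost of [N' / u] times
     the mean [s / v <= eta]. The term of [z], at least [N' * gamma / u], pays for this and for the
     harmonic drop [m / u]; hence the factor [gamma - eta] in [m]. *)
  have key : N' / v%:R * s <= N' / u%:R * s + N' / u%:R * eta.
    have [v0|v0] := posnP v.
      rewrite v0 mul0r in sv; have -> : s = 0 by apply/eqP; rewrite eq_le sv.
      rewrite !mulr0 add0r.
      by apply: mulr_ge0; [exact: N'k|exact: ltW].
    have vR : 0 < v%:R :> R by rewrite ltr0n.
    have uv : u%:R = v%:R + 1 :> R by rewrite cu -natr1.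
    have -> : N' / v%:R * s = N' / u%:R * s + N' / u%:R * (s / v%:R).
      by rewrite uv; field; rewrite -uv !gt_eqF.
    by rewrite lerD2l ler_wpM2l ?N'k // ler_pdivrMr // mulrC.
  have od' : N' / u%:R * gamma <= N' / u%:R * occ p M z z.
    by rewrite ler_wpM2l ?N'k.
  have mE : m / u%:R = N' / u%:R * gamma - N' / u%:R * eta.
    by rewrite /m; ring.
  rewrite mulrDr mE; lra.
rewrite WT; apply: le_trans (_ : \sum_z p x z * g z <= _); last first.
  by apply: ler_sum => z _; rewrite ler_wpM2l.
have -> : \sum_z p x z * g z = g x - N' / u%:R * \sum_(y in U) kpow p M x y.
  have pg z : p x z * g z = p x z * (m * harmonic_sum u) -
      N' / u%:R * \sum_(y in U) p x z * occ p M z y.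
    by rewrite -mulr_sumr /g; ring.
  under eq_bigr do rewrite pg.
  rewrite sumrB -mulr_suml p_sum -mulr_sumr exchange_big /=.
  have -> : \sum_(y in U) \sum_z p x z * occ p M z y =
      \sum_(y in U) (occ p M x y + kpow p M x y).
    apply: eq_bigr => y; rewrite inE => /andP[yW _]; rewrite occ_step //.
    suff -> : (x == y) = false by rewrite subr0.
    by apply: contraNF yW => /eqP <-.
  rewrite big_split /= /g; ring.
rewrite -/(g x) lerD2l lerN2.
apply: le_trans (_ : N' / u%:R * (u%:R * ((1 + eta) / N)) <= _).
  rewrite ler_wpM2l ?N'k //.
  by rewrite mulr_natl -sumr_const; apply: ler_sum => y _.
rewrite le_eqVlt; apply/orP; left; apply/eqP; rewrite /N'; field.
by rewrite !gt_eqF //; lra.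
Qed.

Lemma harmonic_sum_ge0 n : 0 <= harmonic_sum n.
Proof. by apply: sumr_ge0 => i _; rewrite invr_ge0 ler0n. Qed.

Lemma le_harmonic_sum m n : (m <= n)%N -> harmonic_sum m <= harmonic_sum n.
Proof.
move=> /subnKC <-; rewrite /harmonic_sum big_split_ord /= lerDl.
by apply: sumr_ge0 => i _; rewrite invr_ge0 ler0n.
Qed.

Lemma ln_le_harmonic_sum n : ln n.+1%:R <= harmonic_sum n.
Proof.
elim: n => [|n IH]; first by rewrite ln1 harmonic_sum_ge0.
rewrite /harmonic_sum big_ord_recr /= -/(harmonic_sum n).
have n0 : 0 < n.+1%:R :> R by rewrite ltr0n.
have -> : n.+2%:R = n.+1%:R * (1 + n.+1%:R^-1) :> R.
  by rewrite mulrDr mulr1 mulfV ?gt_eqF // natr1.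
have i0 : 0 < n.+1%:R^-1 :> R by rewrite invr_gt0.
rewrite lnM ?posrE ?addr_gt0 // lerD // le_ln1Dx //.
by apply: lt_trans i0; rewrite ltrN10.
Qed.

(** The drift inequality is summed over [n] steps instead of stopping at the cover time; the
    leftover potential is 0 when everything is covered and at most [m * harmonic_sum #|S|]
    otherwise. *)
Lemma matthews_lower (eta gamma : R) M S n : (0 < #|S|)%N ->
  0 < eta -> eta <= gamma ->
  (forall x y, kpow p M x y <= (1 + eta) / N) ->
  (forall y, y \in S -> gamma <= occ p M y y) ->
  (forall x y, x \in S -> y \in S -> x != y -> occ p M x y <= eta) ->
  (forall x y, occ p M x y <= gamma) ->
  N / (1 + eta) * ((gamma - eta) * ln #|S|%:R - gamma) <=
  \sum_(t < n) walk_exp p t uncovered +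
  N / (1 + eta) * (gamma - eta) * harmonic_sum #|S| * walk_exp p n uncovered.
Proof.
move=> S0 eta0 etag mixM occD occO occS.
have V0 : (0 < #|V|)%N by apply: leq_trans S0 (max_card _).
have N0 : 0 < N by rewrite ltr0n.
set N' := N / (1 + eta); set m := N' * (gamma - eta).
have N'0 : 0 < N' by rewrite divr_gt0 //; lra.
have N'k k : 0 <= N' / k%:R by apply: divr_ge0; [exact: ltW|exact: ler0n].
have m0 : 0 <= m by rewrite mulr_ge0 ?(ltW N'0) //; lra.
pose f := matthews m N' M S.
have fstep x W : x \in W -> f x W - uncovered x W <= kstep p f x W.
  exact: (matthews_step V0 eta0 mixM occD occO).
have tele k x W : x \in W ->
    f x W <= \sum_(t < k) iter t (kstep p) uncovered x W + iter k (kstep p) f x W.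
  elim: k x W => [|k IH] x W xW; first by rewrite big_ord0 add0r.
  rewrite big_ord_recl /=.
  have := fstep x W xW; rewrite lerBlDr => /le_trans; apply.
  rewrite addrC -addrA lerD2l.
  apply: le_trans (kstep_le IH xW) _.
  rewrite [leLHS]/kstep; under [leLHS]eq_bigr do rewrite mulrDr mulr_sumr.
  by rewrite big_split /= exchange_big.
have f_ub x W : f x W <= m * harmonic_sum #|S| * uncovered x W.
  have occ0 z B : 0 <= \sum_(y in B) occ p M z y.
    by apply: sumr_ge0 => y _; exact: occ_ge0.
  rewrite /f /matthews /uncovered; have [->|WT] := eqVneq W [set: V]%SET.
    by rewrite finset.setDT cards0 /harmonic_sum big_ord0 big_set0 !mulr0 subr0.
  rewrite mulr1; apply: le_trans (_ : m * harmonic_sum #|S :\: W| <= _).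
    by rewrite gerBl; apply: mulr_ge0.
  by rewrite ler_wpM2l // le_harmonic_sum // subset_leq_card // finset.subsetDl.
have f_lb x : N' * ((gamma - eta) * ln #|S|%:R - gamma) <= f x [set x].
  rewrite mulrBr mulrA -/m /f /matthews; set U := S :\: [set x].
  apply: lerB.
    rewrite ler_wpM2l //.
    (* The start may lie in [S], leaving [#|S| - 1] points; their harmonic sum is still at least
       [ln #|S|]. *)
    case E : #|S| S0 => [//|s] _.
    apply: le_trans (ln_le_harmonic_sum s) _; apply: le_harmonic_sum.
    by rewrite -ltnS -E (cardsD1 x) -add1n leq_add2r; case: (x \in S).
  have [U0|U0] := posnP #|U|.
    rewrite U0 invr0 mulr0 mul0r mulr_ge0 ?(ltW N'0) //; lra.
  have UR : 0 < #|U|%:R :> R by rewrite ltr0n.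
  apply: le_trans (_ : N' / #|U|%:R * (#|U|%:R * gamma) <= _).
    rewrite ler_wpM2l ?N'k //.
    by rewrite mulr_natl -sumr_const; apply: ler_sum.
  by rewrite mulrA divfK ?gt_eqF.
apply: le_trans (_ : walk_exp p 0 f <= _).
  rewrite /walk_exp /= [leRHS]mulrC ler_pdivlMr //.
  rewrite mulr_natr -sumr_const; apply: ler_sum => x _; exact: f_lb.
apply: le_trans (_ : \sum_(t < n) walk_exp p t uncovered + walk_exp p n f <= _).
  rewrite /walk_exp -mulr_sumr -mulrDr ler_wpM2l ?invr_ge0 ?ler0n //.
  rewrite exchange_big -big_split; apply: ler_sum => x _; apply: tele.
  exact: set11.
rewrite lerD2l -walk_expZ; apply: walk_exp_le => x W _; exact: f_ub.
Qed.

End Visited.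

(** * Exponential rates *)

Section Rates.
Variables (R : realType) (V : finType) (p : V -> V -> R).
Hypothesis pP : lazy_symmetric p.
Variables (eta gamma : R) (M : nat).
Implicit Types (x y : V) (A S : {set V}).

Local Notation N := (#|V|%:R : R).

Definition nearly_mixed : Prop :=
  [/\ M%:R <= eta * N,
      forall x y, (1 - eta) / N <= kpow p M x y <= (1 + eta) / N,
      forall y, occ p M y y = gamma & 1 <= gamma].

Hypothesis mixed : nearly_mixed.
Hypothesis eta_gt0 : 0 < eta.
Hypothesis eta_small : eta <= 6^-1.
Hypothesis V_gt0 : (0 < #|V|)%N.

Let N_gt0 : 0 < N. Proof. by rewrite ltr0n. Qed.
Let g_ge1 : 1 <= gamma. Proof. by case: mixed. Qed.
Let Ng_gt0 : 0 < N * gamma.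
Proof. by rewrite mulr_gt0 // (lt_le_trans ltr01). Qed.

(** Positive semidefiniteness bounds each entry by the mean of two diagonal ones, and the diagonal
    of [occ M] is constant. *)
Lemma occ_le_gamma x y : occ p M x y <= gamma.
Proof.
have [_ _ occD _] := mixed.
apply: le_trans (_ : 2^-1 * (occ p M x x + occ p M y y) <= _); last first.
  by rewrite !occD; lra.
rewrite -big_split mulr_sumr; apply: ler_sum => t _; exact: kpow_le_diag.
Qed.

(** [msurv_le] with [K = 1 / eta] loses a factor [1 / (1 + eta)] in the rate; this, the factor
    [1 - eta] and [gamma + eta <= gamma * (1 + eta)] fit into [1 - 3 * eta]. *)
Lemma msurv_upper A t : (0 < #|A|)%N ->
  (forall x, \sum_(y in A) occ p M x y <= gamma + eta) ->
  msurv p A t <=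
    (1 + eta^-1) * expR (- (t%:R * (#|A|%:R * (1 - 3 * eta) / (N * gamma)))).
Proof.
move=> A0 occA; have [_ mixM _ _] := mixed.
have l0 : 0 < #|A|%:R :> R by rewrite ltr0n.
have := @msurv_le _ _ _ pP A M eta (gamma + eta) eta^-1 t A0.
rewrite eta_gt0 invr_gt0 => /(_ _ _ _ _ occA).
have ge0 : 0 < gamma + eta by have := g_ge1; have := eta_gt0; lra.
move=> /(_ _ ge0 eta_gt0) h; apply: le_trans (h _ _) _.
- by have := eta_small; lra.
- by move=> x y; case/andP: (mixM x y).
rewrite ler_wpM2l ?addr_ge0 ?invr_ge0 ?(ltW eta_gt0) // ler_expR lerN2.
rewrite ler_wpM2l ?ler0n //.
have -> : eta^-1 / (1 + eta^-1) = (1 + eta)^-1.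
  by field; have := eta_gt0; move=> e0; rewrite !gt_eqF //; lra.
rewrite [leRHS]mulrA ler_pdivlMr ?mulr_gt0 //.
have -> : #|A|%:R * (1 - 3 * eta) / (N * gamma) * (N * (gamma + eta)) =
    #|A|%:R * ((1 - 3 * eta) * ((gamma + eta) / gamma)).
  by field; rewrite !gt_eqF // (lt_le_trans ltr01).
rewrite [leRHS]mulrCA ler_wpM2l ?ler0n // [leRHS]mulrC ler_pdivlMr; last first.
  by have := eta_gt0; lra.
have h1 : (gamma + eta) / gamma <= 1 + eta.
  rewrite ler_pdivrMr; last by rewrite (lt_le_trans ltr01).
  have : 0 <= eta * (gamma - 1).
    by rewrite mulr_ge0 ?(ltW eta_gt0) // subr_ge0.
  by rewrite mulrDl mul1r lerD2l; lra.
apply: le_trans (_ : (1 - 3 * eta) * (1 + eta) * (1 + eta) <= _).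
  rewrite ler_wpM2r //; first by have := eta_gt0; lra.
  by rewrite ler_wpM2l //; have := eta_small; lra.
have := eta_gt0; have := eta_small => e6 e0.
have : 0 <= eta * eta by rewrite mulr_ge0 // ltW.
have : 0 <= eta * eta * eta by rewrite !mulr_ge0 // ltW.
lra.
Qed.

Lemma exp_le_1subr (q : R) : q < 1 -> expR (- (q / (1 - q))) <= 1 - q.
Proof.
move=> q1; have q0 : 0 < 1 - q by lra.
rewrite expRN -[leRHS]invrK lef_pV2 ?posrE ?expR_gt0 ?invr_gt0 //.
apply: le_trans (expR_ge1Dx _); rewrite le_eqVlt; apply/orP; left; apply/eqP.
by field; rewrite gt_eqF.
Qed.

Lemma exists_pow2 (x : R) : 1 <= x -> exists j, x <= (2 ^ j)%:R <= 2 * x.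
Proof.
move=> x1; have x0 : 0 <= x by lra.
have n0 : (0 < Num.truncn x)%N by rewrite truncn_gt0.
have /andP[jn nj] := trunc_log_bounds (ltnSn 1) n0.
exists (trunc_log 2 (Num.truncn x)).+1; apply/andP; split.
  apply: le_trans (ltW (truncnS_gt x)) _; by rewrite ler_nat.
rewrite expnS natrM ler_pM2l ?ltr0n //.
by apply: le_trans (_ : (Num.truncn x)%:R <= _); rewrite ?ler_nat ?truncn_le.
Qed.

(** Time [t] is covered by [J = 2 ^ j] windows of length [s], each survived with probability at
    least [1 - q]. The [M] extra steps and the rounding of [s] waste at most [2 * eta * N] per
    window, hence [4 * l * zeta * L] in the exponent. *)
Lemma msurv_lower A t (zeta : R) : 0 < zeta -> eta <= zeta ^+ 2 ->
  zeta <= 1 -> 12 * #|A|%:R * zeta <= 1 -> 1 <= eta * N -> zeta <= ln N ->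
  t%:R <= 2 * (N * gamma) * ln N ->
  expR (- (t%:R * #|A|%:R / (N * gamma)) -
    (4 * #|A|%:R + 72 * #|A|%:R ^+ 2) * zeta * ln N) <= msurv p A t.
Proof.
move=> z0 ez z1 lz eN zL tb; have [MN _ occD _] := mixed.
set L := ln N in zL tb *; set l : R := #|A|%:R.
have l0 : 0 <= l by exact: ler0n.
have L0 : 0 < L by exact: lt_le_trans zL.
(* The number of windows is a power of two because [msurv_exp2] works by doubling. *)
have [j /andP[j1 j2]] : exists j, L / zeta <= (2 ^ j)%:R <= 2 * (L / zeta).
  by apply: exists_pow2; rewrite ler_pdivlMr // mul1r.
set J : R := (2 ^ j)%:R in j1 j2.
have J0 : 0 < J by rewrite ltr0n expn_gt0.
pose s := (t %/ 2 ^ j).+1.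
have ts : (t <= 2 ^ j * s)%N by rewrite mulnC ltnW // ltn_ceil // expn_gt0.
have Js : J * s%:R <= t%:R + J.
  rewrite -natrM -natrD ler_nat mulnS addnC leq_add2r mulnC.
  exact: leq_divM.
pose q := l * (M + s)%:R / (N * gamma).
have q0 : 0 <= q by apply: divr_ge0; [rewrite mulr_ge0|exact: ltW].
have Jq : J * q <= t%:R * l / (N * gamma) + 4 * l * zeta * L.
  have : J * (M + s)%:R <= t%:R + 2 * (eta * N) * J.
    rewrite natrD mulrDr addrC; apply: le_trans (lerD Js (lexx _)) _.
    rewrite -addrA lerD2l -[X in X + _]mulr1 -mulrDr mulrC ler_wpM2r ?(ltW J0) //.
    lra.
  move=> h; have Nginv : 0 <= l / (N * gamma) by rewrite divr_ge0 // ltW.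
  have -> : J * q = l / (N * gamma) * (J * (M + s)%:R) by rewrite /q; ring.
  apply: le_trans (ler_wpM2l Nginv h) _.
  rewrite mulrDr; apply: lerD; first by rewrite mulrC mulrA.
  have -> : l / (N * gamma) * (2 * (eta * N) * J) = l * (2 * (eta * J) / gamma).
    by field; rewrite !gt_eqF // (lt_le_trans ltr01).
  have -> : 4 * l * zeta * L = l * (4 * zeta * L) by ring.
  rewrite ler_wpM2l // ler_pdivrMr; last by rewrite (lt_le_trans ltr01).
  apply: le_trans (_ : 4 * zeta * L * 1 <= _); last first.
    by rewrite ler_wpM2l // !mulr_ge0 // ltW.
  rewrite mulr1.
  have : eta * J <= zeta ^+ 2 * (2 * (L / zeta)).
    by apply: ler_pM; rewrite ?(ltW eta_gt0) ?(ltW J0).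
  have -> : zeta ^+ 2 * (2 * (L / zeta)) = 2 * zeta * L.
    by field; rewrite gt_eqF.
  lra.
have Jq6 : J * q <= 6 * l * L.
  apply: le_trans Jq _.
  have : t%:R * l / (N * gamma) <= 2 * l * L.
    rewrite ler_pdivrMr //; apply: le_trans (ler_wpM2r l0 tb) _.
    by rewrite le_eqVlt; apply/orP; left; apply/eqP; ring.
  have : 0 <= (1 - zeta) * (l * L) by rewrite !mulr_ge0 ?subr_ge0 // ltW.
  lra.
have q4 : q <= 6 * l * zeta.
  rewrite -(ler_pM2l J0); apply: le_trans Jq6 _.
  have -> : J * (6 * l * zeta) = 6 * l * (J * zeta) by ring.
  rewrite ler_wpM2l ?mulr_ge0 //.
  by rewrite -ler_pdivrMr.
have q2 : q <= 2^-1 by rewrite -/l in lz; lra.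
apply: le_trans (msurv_decr pP A ts); apply: le_trans (msurv_exp2 pP A s j V_gt0).
have q1 : 0 <= 1 - q by lra.
have sq : 1 - q <= msurv p A s.
  have := @msurv_ge _ _ _ pP A M gamma s V_gt0; apply.
    exact: lt_le_trans g_ge1.
  by move=> y _; rewrite occD.
apply: le_trans (_ : (1 - q) ^+ (2 ^ j) <= _); last first.
  by rewrite lerXn2r // nnegrE // msurv_ge0.
apply: le_trans (_ : expR (- (q / (1 - q))) ^+ (2 ^ j) <= _); last first.
  by rewrite lerXn2r ?nnegrE ?expR_ge0 // exp_le_1subr //; lra.
rewrite -expRM_natl -/J ler_expR mulrN -opprB opprK lerN2.
(* The last product is the second-order loss, at most [6 * l * L] times [12 * l * zeta]: the origin
   of the constant 72. *)
have -> : J * (q / (1 - q)) = J * q + J * q * (q / (1 - q)).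
  by field; rewrite gt_eqF //; lra.
have qq : q / (1 - q) <= 12 * l * zeta.
  rewrite ler_pdivrMr; last by lra.
  have : 0 <= 12 * l * zeta * (2^-1 - q).
    by rewrite !mulr_ge0 ?(ltW z0) ?subr_ge0.
  lra.
have : J * q * (q / (1 - q)) <= 6 * l * L * (12 * l * zeta).
  by apply: ler_pM => //; [rewrite mulr_ge0 ?(ltW J0)|rewrite divr_ge0].
lra.
Qed.

End Rates.

(** * Two-sided estimates of the expected cover time *)

Section CoverRates.
Variables (R : realType) (V : finType) (p : V -> V -> R).
Hypothesis pP : lazy_symmetric p.
Variables (eta gamma : R) (M : nat).
Implicit Types (x y : V) (A S : {set V}).

Local Notation N := (#|V|%:R : R).
Local Notation uncovered := (@uncovered R V).

Hypothesis mixed : nearly_mixed p eta gamma M.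
Hypothesis eta_gt0 : 0 < eta.
Hypothesis eta_small : eta <= 6^-1.
Hypothesis V_gt0 : (0 < #|V|)%N.

Let N_gt0 : 0 < N. Proof. by rewrite ltr0n. Qed.
Let g_ge1 : 1 <= gamma. Proof. by case: mixed. Qed.
Let Ng_gt0 : 0 < N * gamma.
Proof. by rewrite mulr_gt0 // (lt_le_trans ltr01). Qed.
Let Ng_ge1 : 1 <= N * gamma.
Proof. by rewrite mulr_ege1 // ler1n. Qed.

Local Notation b := ((1 - 3 * eta) / (N * gamma)).

Let b_gt0 : 0 < b.
Proof. by rewrite divr_gt0 //; have := eta_small; lra. Qed.

Lemma walk_exp_uncovered_le1 t : walk_exp p t uncovered <= 1.
Proof.
apply: le_trans (_ : walk_exp p t (fun x W => [disjoint W & finset.set0]%B%:R) <= _).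
  apply: walk_exp_le => // x W _.
  rewrite -finset.setI_eq0 finset.setI0 eqxx /uncovered.
  by case: (_ != _); rewrite ?lexx ?ler01.
rewrite walk_exp_avoid // /msurv mulrC ler_pdivrMr // mul1r.
have h s x : surv p finset.set0 s x = 1.
  elim: s x => [|s IH] x /=; first by rewrite inE.
  rewrite inE mul1r; under eq_bigr do rewrite IH mulr1.
  by case: pP => _ _ ->.
by under eq_bigr do rewrite h; rewrite sumr_const.
Qed.

Lemma uncovered_upper t :
  walk_exp p t uncovered <= N * ((1 + eta^-1) * expR (- (t%:R * b))).
Proof.
apply: le_trans (uncovered_le pP t) _.
rewrite mulr_natl -sumr_const; apply: ler_sum => y _.
have := @msurv_upper _ _ _ pP _ _ _ mixed eta_gt0 eta_small V_gt0 [set y]%SET t.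
rewrite cards1 mul1r; apply=> // x; rewrite big_set1.
apply: le_trans (occ_le_gamma pP mixed x y) _.
by rewrite lerDl ltW.
Qed.

Lemma sum_expR_le n : \sum_(s < n) expR (- (s%:R * b)) <= 1 + b^-1.
Proof.
set r := expR (- b); have r0 : 0 < r by exact: expR_gt0.
have r1 : r <= (1 + b)^-1.
  rewrite /r expRN lef_pV2 ?posrE ?expR_gt0 ?addr_gt0 //.
  exact: expR_ge1Dx.
under eq_bigr do rewrite -mulrN expRM_natl -/r.
have rb : b / (1 + b) <= 1 - r.
  have -> : b / (1 + b) = 1 - (1 + b)^-1.
    have b0 := b_gt0; move: b b0 => u u0; field.
    by rewrite !gt_eqF //; lra.
  by rewrite lerD2l lerN2.
have bb : 0 < b / (1 + b) by rewrite divr_gt0 // addr_gt0.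
have -> : 1 + b^-1 = (b / (1 + b))^-1.
  have b0 := b_gt0; move: b b0 => u u0; field.
  by rewrite !gt_eqF //; lra.
rewrite -[leRHS]mul1r ler_pdivlMr //.
apply: le_trans (_ : (\sum_(s < n) r ^+ s) * (1 - r) <= _).
  by rewrite ler_wpM2l // sumr_ge0 // => s _; rewrite exprn_ge0 // ltW.
have := subrX1 r n; rewrite -opprB -[in X in _ = X]opprB mulNr.
move=> /oppr_inj; rewrite mulrC => <-.
by rewrite gerBl exprn_ge0 // ltW.
Qed.

Lemma sum_uncovered_le n :
  \sum_(t < n) walk_exp p t uncovered <=
    N * gamma * ((1 + 6 * eta) * ln N + 4 + 3 / eta).
Proof.
set L := ln N; have L0 : 0 <= L by rewrite ln_ge0 // ler1n.
have e0 := eta_gt0; have e6 := eta_small.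
have i0 : 0 < eta^-1 by rewrite invr_gt0.
have u0 t : 0 <= walk_exp p t uncovered.
  have -> : 0 = walk_exp p t (fun x W => 0 * uncovered x W).
    by rewrite walk_expZ mul0r.
  by apply: walk_exp_le => // x W _; rewrite mul0r ler0n.
(* At [t0] the union factor [N * exp (- t * b)] falls below one: earlier times are counted in full,
   later ones form a geometric series. *)
pose t0 := (Num.truncn (L / b)).+1.
have t0_ge : L / b <= t0%:R by apply: ltW; exact: truncnS_gt.
have t0_le : t0%:R <= L / b + 1.
  by rewrite /t0 -natr1 lerD2r truncn_le; apply: divr_ge0 => //; exact: ltW.
apply: le_trans (_ : \sum_(t < t0 + n) walk_exp p t uncovered <= _).
  by rewrite addnC big_split_ord /= lerDl sumr_ge0.
rewrite big_split_ord /=.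
have h1 : \sum_(t < t0) walk_exp p t uncovered <= t0%:R.
  rewrite -[leRHS]mulr1 mulr_natl -[in leRHS](card_ord t0) -sumr_const.
  by apply: ler_sum => t _; exact: walk_exp_uncovered_le1.
have h2 : \sum_(s < n) walk_exp p (t0 + s) uncovered <=
    (1 + eta^-1) * (1 + b^-1).
  apply: le_trans (_ : (1 + eta^-1) * \sum_(s < n) expR (- (s%:R * b)) <= _);
    last by rewrite ler_wpM2l ?sum_expR_le // addr_ge0 // ltW.
  rewrite mulr_sumr; apply: ler_sum => s _.
  apply: le_trans (uncovered_upper _) _; rewrite mulrCA ler_wpM2l //.
    by rewrite addr_ge0 // ltW.
  apply: le_trans (_ : expR L * expR (- ((t0 + s)%:R * b)) <= _).
    by rewrite /L lnK.
  rewrite -expRD ler_expR natrD.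
  rewrite mulrDl opprD addrA -[leRHS]add0r lerD2r subr_le0.
  by rewrite -ler_pdivrMr.
(* [(1 - 3 * eta) * (1 + 6 * eta) >= 1] holds exactly because [eta <= 1 / 6]. *)
have bi : b^-1 <= N * gamma * (1 + 6 * eta).
  rewrite invf_div ler_pdivrMr; last lra.
  rewrite -[leRHS]mulrA -[leLHS]mulr1 ler_wpM2l ?(ltW Ng_gt0) //.
  have : 0 <= eta * (6^-1 - eta) by rewrite mulr_ge0 ?subr_ge0 // ltW.
  lra.
have bi2 : b^-1 <= 2 * (N * gamma).
  apply: le_trans bi _; rewrite mulrC ler_wpM2r ?(ltW Ng_gt0) //; lra.
have Lb : L / b <= L * (N * gamma * (1 + 6 * eta)) by rewrite ler_wpM2l.
have h3 : (1 + eta^-1) * (1 + b^-1) <= (1 + eta^-1) * (3 * (N * gamma)).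
  rewrite ler_wpM2l ?addr_ge0 ?(ltW i0) //; have := Ng_ge1; lra.
have -> : N * gamma * ((1 + 6 * eta) * L + 4 + 3 / eta) =
  L * (N * gamma * (1 + 6 * eta)) + N * gamma +
     (1 + eta^-1) * (3 * (N * gamma)) by field; rewrite gt_eqF.
have := Ng_ge1; lra.
Qed.

Lemma sum_uncovered_ge S (c : R) :
  (1 - eta) * ln N <= ln #|S|%:R ->
  (forall x y, x \in S -> y \in S -> x != y -> occ p M x y <= eta) ->
  (forall n, \sum_(t < n) walk_exp p t uncovered <= c) ->
  N * gamma * ((1 - 3 * eta) * ln N - 1) <= c.
Proof.
move=> lnS occS sumc; have [_ mixM occD _] := mixed.
set L := ln N in lnS *; have L0 : 0 <= L by rewrite ln_ge0 // ler1n.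
have e0 := eta_gt0; have e6 := eta_small.
have c0 : 0 <= c by have := sumc 0%N; rewrite big_ord0.
have Ng0 := ltW Ng_gt0.
(* A nonpositive bound is trivial; otherwise [ln N > 0], which forces [S] to be nonempty. *)
have [L1|L1] := leP ((1 - 3 * eta) * L - 1) 0.
  by apply: le_trans c0; rewrite mulr_ge0_le0.
have S0 : (0 < #|S|)%N.
  rewrite lt0n; apply/eqP => S0; move: lnS.
  rewrite S0 ln0 // leNgt mulr_gt0 //; first lra.
  rewrite lt_neqAle L0 andbT; apply: contraTneq L1 => <-; lra.
have eg : eta <= gamma by have := g_ge1; lra.
set K := N / (1 + eta) * (gamma - eta) * harmonic_sum R #|S|.
have lower n : N / (1 + eta) * ((gamma - eta) * ln #|S|%:R - gamma) <=
    c + K * (N * ((1 + eta^-1) * expR (- (n%:R * b)))).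
  have := @matthews_lower _ _ _ pP eta gamma M S n S0 eta_gt0 eg.
  move=> /(_ _ _ occS (occ_le_gamma pP mixed)) h; apply: le_trans (h _ _) _.
  - by move=> x y; case/andP: (mixM x y).
  - by move=> y _; rewrite occD.
  apply: lerD; first exact: sumc.
  rewrite ler_wpM2l ?uncovered_upper //.
  rewrite mulr_ge0 ?harmonic_sum_ge0 // mulr_ge0 ?subr_ge0 //.
  by rewrite divr_ge0 ?(ltW N_gt0) //; lra.
(* The remainder decays exponentially in [n]: beyond [Q / (e * b)] it is at most [e]. *)
have lim : N / (1 + eta) * ((gamma - eta) * ln #|S|%:R - gamma) <= c.
  apply/ler_addgt0Pr => e ee.
  have K0 : 0 <= K * (N * (1 + eta^-1)).
    rewrite !mulr_ge0 ?invr_ge0 ?harmonic_sum_ge0 ?subr_ge0 ?addr_ge0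
      ?invr_ge0 ?(ltW N_gt0) ?(ltW e0) //.
  set Q := K * (N * (1 + eta^-1)) in K0.
  pose n := (Num.truncn (Q / (e * b))).+1.
  apply: le_trans (lower n) _; rewrite lerD2l.
  have -> : K * (N * ((1 + eta^-1) * expR (- (n%:R * b)))) =
    Q * expR (- (n%:R * b)) by rewrite /Q; ring.
  rewrite expRN ler_pdivrMr ?expR_gt0 //.
  have : Q / (e * b) <= n%:R by apply: ltW; exact: truncnS_gt.
  rewrite ler_pdivrMr ?(mulr_gt0 ee b_gt0) // => /le_trans; apply.
  rewrite mulrCA ler_wpM2l ?(ltW ee) //.
  by apply: le_trans (expR_ge1Dx _); rewrite lerDr.
apply: le_trans lim.
have -> : N * gamma * ((1 - 3 * eta) * L - 1) =
  N / (1 + eta) * (gamma * ((1 + eta) * ((1 - 3 * eta) * L - 1))).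
  by field; rewrite gt_eqF //; lra.
rewrite ler_wpM2l ?divr_ge0 ?(ltW N_gt0) //; first lra.
have gS : gamma * ((1 - eta) * ((1 - eta) * L)) <= (gamma - eta) * ln #|S|%:R.
  have g1 := g_ge1.
  have h1 : 0 <= gamma * (1 - eta) by apply: mulr_ge0; lra.
  have h2 : 0 <= (1 - eta) * L by apply: mulr_ge0 => //; lra.
  have h3 : gamma * (1 - eta) <= gamma - eta.
    have : 0 <= eta * (gamma - 1) by apply: mulr_ge0; lra.
    lra.
  by have := ler_pM h1 h2 h3 lnS; rewrite -mulrA.
have h0 : 0 <= eta * eta * L by rewrite !mulr_ge0 // ltW.
have : 0 <= gamma * ((1 - eta) * ((1 - eta) * L) - 1 -
    (1 + eta) * ((1 - 3 * eta) * L - 1)).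
  by apply: mulr_ge0; have := g_ge1; lra.
lra.
Qed.

End CoverRates.

(** * Choice of constants and budget of the exponents *)

Section LateConstants.
Variables (R : realType) (l m : R).
Hypothesis l1 : 1 <= l.
Hypothesis m01 : 0 < m <= 1.

Lemma late_constant_exists : exists zeta : R,
  [/\ 0 < zeta, zeta <= 100^-1, 100 * zeta * l <= m, 100 * zeta * l ^+ 2 <= m
    & 100 * zeta ^+ 2 * l <= m / 100].
Proof.
have /andP[m0 m1] := m01; have l1' := l1.
(* [zeta] will be [m * d]; the square of [l + 1] dominates both [l] and [l ^ 2]. *)
pose d : R := (100 * (l + 1) ^+ 2)^-1.
have d0 : 0 < d by rewrite invr_gt0 mulr_gt0 // exprn_gt0 //; lra.
have dE : 100 * d * (l + 1) ^+ 2 = 1 by rewrite /d; field; rewrite gt_eqF //; lra.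
have dl1 : 100 * d * l <= 1.
  rewrite -[leRHS]dE ler_wpM2l //; first by rewrite mulr_ge0 // ltW.
  by rewrite sqrrD !expr1n; have := sqr_ge0 l; lra.
have dl2 : 100 * d * l ^+ 2 <= 1.
  rewrite -[leRHS]dE ler_wpM2l //; first by rewrite mulr_ge0 // ltW.
  by rewrite sqrrD !expr1n; lra.
have d1 : d <= 100^-1.
  have : 0 <= 100 * d * (l - 1) by rewrite !mulr_ge0 ?(ltW d0) // subr_ge0.
  lra.
have z1 : m * d <= 100^-1.
  by apply: le_trans d1; rewrite -[leRHS]mul1r ler_wpM2r // ltW.
have z0 : 0 < m * d by rewrite mulr_gt0.
have zl : 100 * (m * d) * l <= m by have := ler_wpM2l (ltW m0) dl1; rewrite mulr1; lra.
exists (m * d); split=> //; first by have := ler_wpM2l (ltW m0) dl2; rewrite mulr1; lra.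
have l0 : 0 <= l by lra.
have := ler_wpM2r l0 (ler_wpM2l (ltW z0) z1); rewrite -expr2; lra.
Qed.

Variables (alpha zeta a i L : R).
Hypothesis alpha01 : 0 < alpha < 1.
Hypothesis zeta0 : 0 < zeta.
Hypothesis zl1 : 100 * zeta * l <= m.
Hypothesis zl2 : 100 * zeta * l ^+ 2 <= m.
Hypothesis el : 100 * zeta ^+ 2 * l <= m / 100.
Hypothesis L0 : 0 < L.
Hypothesis a0 : 0 < a.

(** Budget within [m * L]: [8 / 10] for the windows, [1 / 100] for the cover factor [1 + 6 * eta],
    [1 / 10] for the additive constant [a]. *)
Lemma late_lower_exponent : l * a <= m * L / 10 ->
  l * alpha * ((1 + 6 * zeta ^+ 2) * L + a) +
    (4 * l + 72 * l ^+ 2) * zeta * L <= (l * alpha + m) * L.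
Proof.
move=> laL; have /andP[al0 al1] := alpha01; have /andP[m0 _] := m01.
have e0 : 0 < zeta ^+ 2 by rewrite exprn_gt0.
move: (zeta ^+ 2) el e0 => eta elm e0.
have h1 : 0 <= l * (1 - alpha) * (6 * eta * L + a).
  apply: mulr_ge0; first by apply: mulr_ge0; [move: l1; lra|rewrite subr_ge0 ltW].
  by rewrite addr_ge0 ?(ltW a0) // !mulr_ge0 // ltW.
have h2 : (4 * l + 72 * l ^+ 2) * zeta * L <= 8 / 10 * m * L.
  rewrite ler_wpM2r ?(ltW L0) //; move: zl1 zl2 m0; lra.
have h3 : (6 * eta * l) * L <= m / 100 * L.
  rewrite ler_wpM2r ?(ltW L0) //; move: elm m0; lra.
have h5 : 0 < m * L by rewrite mulr_gt0.
move: h1 h2 h3 h5 laL; lra.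
Qed.

(** One [l] comes from the [- 1] in the lower bound on the cover time, the other from rounding
    [alpha * c] to an integer; [i = 1 / eta] comes from the prefactor [1 + 1 / eta <= exp i]. *)
Lemma late_upper_exponent : 2 * l + i <= m * L / 10 ->
  6 * zeta ^+ 2 <= 1 ->
  i - (alpha * l * (1 - 3 * zeta ^+ 2) * ((1 - 3 * zeta ^+ 2) * L - 1) - l)
    <= (- (l * alpha) + m) * L.
Proof.
move=> liL; have /andP[al0 al1] := alpha01; have /andP[m0 _] := m01.
have e0 : 0 < zeta ^+ 2 by rewrite exprn_gt0.
move: (zeta ^+ 2) el e0 => eta elm e0 e6.
have l0 : 0 <= l by move: l1; lra.
have h1 : 0 <= 6 * eta * l * L * (1 - alpha).
  by rewrite !mulr_ge0 ?(ltW e0) ?(ltW L0) // subr_ge0 ltW.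
have h2 : 0 <= l * (1 - alpha * (1 - 3 * eta)).
  apply: mulr_ge0 => //; rewrite subr_ge0.
  apply: mulr_ile1; rewrite ?(ltW al0) ?(ltW al1) //; move: e0 e6; lra.
have h3 : 0 <= alpha * l * L * (eta * eta).
  by rewrite !mulr_ge0 ?(ltW e0) ?(ltW L0) ?(ltW al0).
have h4 : (6 * eta * l) * L <= m / 100 * L.
  rewrite ler_wpM2r ?(ltW L0) //; move: elm m0; lra.
have h5 : 0 < m * L by rewrite mulr_gt0.
move: h1 h2 h3 h4 h5 liL; lra.
Qed.

End LateConstants.

Section LateAsymptotics.
Variables (R : realType) (alpha m zeta : R) (l : nat).
Hypothesis alpha01 : 0 < alpha < 1.
Hypothesis l_gt0 : (0 < l)%N.
Hypothesis m01 : 0 < m <= 1.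
Hypothesis zeta0 : 0 < zeta.
Hypothesis zeta1 : zeta <= 100^-1.
Hypothesis zl1 : 100 * zeta * l%:R <= m.
Hypothesis zl2 : 100 * zeta * l%:R ^+ 2 <= m.
Hypothesis el : 100 * zeta ^+ 2 * l%:R <= m / 100.

Local Notation eta := (zeta ^+ 2).
Local Notation i := (eta^-1).
Local Notation a := (4 + 3 / eta).

Variables (V : finType) (p : V -> V -> R) (gamma c : R) (M k : nat).
Variables (A S : {set V}).
Local Notation N := (#|V|%:R : R).
Local Notation L := (ln N).
Hypothesis pP : lazy_symmetric p.
Hypothesis mix : nearly_mixed p eta gamma M.
Hypothesis V_gt0 : (0 < #|V|)%N.
Hypothesis cardA : #|A| = l.
Hypothesis L_large : 10 / m * (l%:R * a + 2 * l%:R + i) + 2 * a + i + 1 <= L.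

Let e0 : 0 < eta. Proof. by rewrite exprn_gt0. Qed.
Let ez : eta <= zeta / 100. Proof. by rewrite expr2; apply: ler_wpM2l zeta1; exact: ltW. Qed.
Let e6 : eta <= 6^-1.
Proof. by move: ez zeta1 => h1 h2; apply: le_trans h1 _; move: h2; lra. Qed.
Let i0 : 0 < i. Proof. by rewrite invr_gt0. Qed.
Let a0 : 0 < a.
Proof. by rewrite addr_gt0 // mulr_gt0. Qed.
Let l0 : 0 < l%:R :> R. Proof. by rewrite ltr0n. Qed.
Let l1 : 1 <= l%:R :> R. Proof. by rewrite ler1n. Qed.
Let g1 : 1 <= gamma. Proof. by case: mix. Qed.
Let N0 : 0 < N. Proof. by rewrite ltr0n. Qed.
Let Ng1 : 1 <= N * gamma.
Proof. by rewrite mulr_ege1 ?g1 // ler1n. Qed.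
Let Ng0 : 0 < N * gamma. Proof. exact: lt_le_trans ltr01 Ng1. Qed.

Let m0 : 0 < m. Proof. by case/andP: m01. Qed.

Let la0 : 0 < l%:R * a. Proof. by rewrite mulr_gt0 ?a0. Qed.

Let C0 : 0 < l%:R * a + 2 * l%:R + i.
Proof. by rewrite !addr_gt0 ?la0 ?i0 // mulr_gt0. Qed.

Let CmL : l%:R * a + 2 * l%:R + i <= m * L / 10.
Proof.
have h : 10 / m * (l%:R * a + 2 * l%:R + i) <= L.
  by move: L_large a0 i0; move: i a (10 / m * _) => w v u; lra.
have := ler_wpM2l (ltW m0) h; rewrite mulrA mulrCA mulfV ?gt_eqF ?m0 // mulr1.
by move: (m * L) (_ + i) => u v; lra.
Qed.

Let aL : 2 * a <= L.
Proof.
have h : 0 < 10 / m * (l%:R * a + 2 * l%:R + i).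
  by rewrite mulr_gt0 ?C0 // divr_gt0 ?m0.
move: L_large i0 h; move: i a (10 / m * _) => w v u; lra.
Qed.

Let iL : i + 1 <= L.
Proof.
have h : 0 < 10 / m * (l%:R * a + 2 * l%:R + i).
  by rewrite mulr_gt0 ?C0 // divr_gt0 ?m0.
move: L_large a0 h; move: i a (10 / m * _) => w v u; lra.
Qed.

Let L0 : 0 < L. Proof. by move: iL i0; move: i => w; lra. Qed.

Hypothesis cov_le : forall n, \sum_(t < n) walk_exp p t (@uncovered R V) <= c.
Hypothesis kc : k%:R < alpha * c <= k.+1%:R.

Lemma late_lower :
  (forall b, (forall n, \sum_(t < n) walk_exp p t (@uncovered R V) <= b) ->
    c <= b) ->
  expR ((- (l%:R * alpha) - m) * L) <= msurv p A k.
Proof.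
move=> cmin; have /andP[al0 al1] := alpha01; have /andP[kc1 _] := kc.
have cU : c <= N * gamma * ((1 + 6 * eta) * L + a).
  apply: cmin => n; apply: le_trans (sum_uncovered_le pP mix e0 e6 V_gt0 n) _.
  by rewrite ler_wpM2l ?(ltW Ng0) // -[leLHS]addrA.
have kU : k%:R <= alpha * (N * gamma * ((1 + 6 * eta) * L + a)).
  by apply: le_trans (ltW kc1) _; rewrite ler_wpM2l // ltW.
have h := @msurv_lower _ _ _ pP eta gamma M mix e0 V_gt0 A k zeta zeta0 (lexx _).
rewrite cardA in h; apply: le_trans (h _ _ _ _ _).
- have kl : k%:R * l%:R / (N * gamma) <=
      l%:R * alpha * ((1 + 6 * eta) * L + a).
    rewrite ler_pdivrMr ?Ng0 //; have := ler_wpM2r (ltW l0) kU.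
    move: (k%:R * _) ((1 + 6 * eta) * L + a) => u v; move/le_trans; apply.
    by rewrite le_eqVlt; apply/orP; left; apply/eqP; ring.
  have laL : l%:R * a <= m * L / 10.
    move: CmL i0 l0; move: i (l%:R * a) (m * L / 10) => v u w; lra.
  have := late_lower_exponent l1 m01 alpha01 zeta0 zl1 zl2 el L0 a0 laL.
  rewrite ler_expR; move: kl; move: (k%:R * _ / _) (_ * zeta * L) => u v.
  move: L (l%:R * alpha) (l%:R * alpha * (_ + a)) => w x y; lra.
- by move: zeta1; lra.
- have := ler_wpM2l (ltW zeta0) l1; move: zl1 m01 zeta1 => h1 /andP[_ h2] h3.
  by move: h1 h2; lra.
- rewrite -[leLHS](mulfV (lt0r_neq0 e0)) ler_wpM2l ?(ltW e0) //.
  apply: le_trans (ltW (ln_sublinear N0)); apply: le_trans iL.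
  by rewrite lerDl.
- by move: iL i0 zeta1; move: i => w; lra.
- apply: le_trans kU _.
  have -> : 2 * (N * gamma) * L = 1 * (N * gamma * (2 * L)) by ring.
  have e12 : 6 * eta * L + a <= L.
    have : 6 * eta * L <= 2^-1 * L.
      rewrite ler_wpM2r ?(ltW L0) //; move: ez zeta1.
      by move: eta => u; lra.
    by move: aL; move: a (6 * eta * L) => v u; lra.
  apply: ler_pM; rewrite ?(ltW al0) ?(ltW al1) //.
    rewrite mulr_ge0 ?(ltW Ng0) // addr_ge0 ?(ltW a0) //.
    by rewrite mulr_ge0 ?(ltW L0) // addr_ge0 // mulr_ge0 // ltW ?e0.
  rewrite ler_wpM2l ?(ltW Ng0) //.
  by move: e12; move: L => w; lra.
Qed.

Lemma late_upper :
  (forall x, \sum_(y in A) occ p M x y <= gamma + eta) ->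
  (1 - eta) * L <= ln #|S|%:R ->
  (forall x y, x \in S -> y \in S -> x != y -> occ p M x y <= eta) ->
  msurv p A k <= expR ((- (l%:R * alpha) + m) * L).
Proof.
move=> occA lnS occS; have /andP[al0 al1] := alpha01; have /andP[_ kc2] := kc.
have cL := sum_uncovered_ge pP mix e0 e6 V_gt0 lnS occS cov_le.
have A_gt0 : (0 < #|A|)%N by rewrite cardA.
apply: le_trans (msurv_upper pP mix e0 e6 V_gt0 k A_gt0 occA) _.
rewrite cardA; apply: le_trans (ler_wpM2r (expR_ge0 _) (expR_ge1Dx i)) _.
rewrite -expRD ler_expR.
have kL : alpha * (N * gamma * ((1 - 3 * eta) * L - 1)) - 1 <= k%:R.
  by rewrite lerBlDr natr1; apply: le_trans kc2; rewrite ler_wpM2l // ltW.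
have e3 : 0 <= 1 - 3 * eta by move: e6 e0; move: eta => u; lra.
have q0 : 0 <= l%:R * (1 - 3 * eta) / (N * gamma).
  by apply: divr_ge0; [apply: mulr_ge0|exact: ltW].
have kl := ler_wpM2r q0 kL.
have h1 : l%:R * (1 - 3 * eta) / (N * gamma) <= l%:R.
  rewrite ler_pdivrMr ?Ng0 //; apply: ler_pM => //.
  by apply: le_trans Ng1; move: e0; move: eta => u; lra.
have E : (alpha * (N * gamma * ((1 - 3 * eta) * L - 1)) - 1) *
    (l%:R * (1 - 3 * eta) / (N * gamma)) =
    alpha * l%:R * (1 - 3 * eta) * ((1 - 3 * eta) * L - 1) -
    l%:R * (1 - 3 * eta) / (N * gamma).
  move: g1 => g1'; field.
  by rewrite !gt_eqF // (lt_le_trans ltr01).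
rewrite E in kl.
have liL : 2 * l%:R + i <= m * L / 10.
  by move: CmL la0; move: i (l%:R * a) (m * L / 10) => v u w; lra.
have e6' : 6 * eta <= 1 by move: e6; move: eta => u; lra.
apply: le_trans (late_upper_exponent l1 m01 alpha01 zeta0 el L0 liL e6').
rewrite lerD2l lerN2; apply: le_trans kl.
by rewrite lerD2l lerN2.
Qed.

End LateAsymptotics.

(** [eta] and [B] depend on [alpha], [eps] and [l] only, so one choice serves the whole sequence of
    graphs. [c] enters as a least upper bound because the expected cover time is the series of the
    [walk_exp]. *)
Lemma late_asymptotics (R : realType) (alpha eps : R) (l : nat) :
  0 < alpha < 1 -> 0 < eps -> (0 < l)%N ->
  exists eta B : R, [/\ 0 < eta, eta <= 6^-1 &
  forall (V : finType) (p : V -> V -> R) (gamma c : R) (M k : nat)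
      (A S : {set V}),
    lazy_symmetric p -> nearly_mixed p eta gamma M -> (0 < #|V|)%N ->
    B <= ln #|V|%:R ->
    #|A| = l ->
    (forall x, \sum_(y in A) occ p M x y <= gamma + eta) ->
    (1 - eta) * ln #|V|%:R <= ln #|S|%:R ->
    (forall x y, x \in S -> y \in S -> x != y -> occ p M x y <= eta) ->
    (forall n, \sum_(t < n) walk_exp p t (@uncovered R V) <= c) ->
    (forall b, (forall n, \sum_(t < n) walk_exp p t (@uncovered R V) <= b) ->
      c <= b) ->
    k%:R < alpha * c <= k.+1%:R ->
    expR ((- (l%:R * alpha) - eps) * ln #|V|%:R) <= msurv p A k
      <= expR ((- (l%:R * alpha) + eps) * ln #|V|%:R)].
Proof.
move=> alpha01 eps0 l_gt0.
pose m : R := Num.min 1 eps.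
have m01 : 0 < m <= 1 by rewrite lt_min ltr01 eps0 ge_min lexx.
have me : m <= eps by rewrite ge_min lexx orbT.
have l1 : 1 <= l%:R :> R by rewrite ler1n.
have [zeta [z0 z1 zl1 zl2 el]] := late_constant_exists l1 m01.
have e0 : 0 < zeta ^+ 2 by rewrite exprn_gt0.
exists (zeta ^+ 2), (10 / m * (l%:R * (4 + 3 / zeta ^+ 2) + 2 * l%:R +
  (zeta ^+ 2)^-1) + 2 * (4 + 3 / zeta ^+ 2) + (zeta ^+ 2)^-1 + 1); split=> //.
  have := ler_wpM2l (ltW z0) z1; rewrite -expr2; move: z1; clear.
  by move: (zeta ^+ 2) => u; lra.
move=> V p gamma c M k A S pP mix V0 BL Al occA lnS occS sumc cmin kc.
have L0 : 0 <= ln #|V|%:R :> R by rewrite ln_ge0 // ler1n.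
have mL := ler_wpM2r L0 me; apply/andP; split.
  apply: le_trans (late_lower alpha01 l_gt0 m01 z0 z1 zl1 zl2 el pP mix V0 Al BL kc cmin).
  by rewrite ler_expR; move: mL; move: (ln _) => u; clear; lra.
apply: le_trans (late_upper alpha01 l_gt0 m01 z0 z1 el pP mix V0 Al BL
  sumc kc occA lnS occS) _.
by rewrite ler_expR; move: mL; move: (ln _) => u; clear; lra.
Qed.

(** * Mixing *)

Section Mixing.
Variables (R : realType) (V : finType) (p : V -> V -> R).
Hypothesis pP : lazy_symmetric p.
Hypothesis V_gt0 : (0 < #|V|)%N.
Implicit Types (x y z : V).

Local Notation N := (#|V|%:R : R).

Let N_gt0 : 0 < N. Proof. by rewrite ltr0n. Qed.

Definition mixed_within (a : R) t : Prop :=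
  forall x y, `|kpow p t x y - N^-1| <= a / N.

(** The uniform kernel absorbs every power on either side, so the deviation from it at time [s + t]
    is the product of the two deviations. *)
Lemma mixed_withinD a b s t : 0 <= a ->
  mixed_within a s -> mixed_within b t -> mixed_within (a * b) (s + t).
Proof.
move=> a0 As Bt x y.
have -> : kpow p (s + t) x y - N^-1 =
    \sum_z (kpow p s x z - N^-1) * (kpow p t z y - N^-1).
  under eq_bigr do rewrite mulrBl !mulrBr opprB.
  rewrite big_split sumrB /= -kpowD // sumrB -!mulr_sumr -mulr_suml.
  rewrite kpow_sum // kpow_suml // sumr_const -[N^-1 *+ _]mulr_natl mulfV ?gt_eqF //.
  by ring.
apply: le_trans (ler_norm_sum _ _ _) _.
apply: le_trans (_ : \sum_(z : V) (a / N) * (b / N) <= _).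
  by apply: ler_sum => z _; rewrite normrM ler_pM.
rewrite sumr_const -mulr_natl le_eqVlt; apply/orP; left; apply/eqP; field.
by rewrite gt_eqF.
Qed.

Lemma mixed_withinM a t k : 0 <= a -> mixed_within a t ->
  mixed_within (a ^+ k.+1) (k.+1 * t).
Proof.
move=> a0 At; elim: k => [|k IH]; first by rewrite mul1n.
by rewrite exprS mulSn; exact: mixed_withinD.
Qed.

Lemma kpow_le_after a s t x y : mixed_within a t ->
  kpow p (s + t) x y <= (1 + a) / N.
Proof.
move=> At; rewrite kpowD //.
apply: le_trans (_ : (\sum_z kpow p s x z) * ((1 + a) / N) <= _);
  last by rewrite kpow_sum // mul1r.
rewrite mulr_suml.
apply: ler_sum => z _; rewrite ler_wpM2l ?kpow_ge0 //.
have := At z y; rewrite ler_norml => /andP[_]; rewrite lerBlDr mulrDl mul1r.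
by rewrite addrC.
Qed.

Variable e : rel V.
Hypothesis e_conn : forall x y, connect e x y.
Hypothesis e_pos : forall x y, e x y -> 0 < p x y.

Lemma kpow_gt0_add s t x y : 0 < kpow p t x y -> 0 < kpow p (s + t) x y.
Proof.
move=> t0; elim: s => [//|s IH]; rewrite addSn /= (bigD1 x) //=.
have [p0 _ _ plazy] := pP.
rewrite ltr_wpDr ?sumr_ge0 //; first by move=> z _; rewrite mulr_ge0 ?kpow_ge0.
by rewrite mulr_gt0 // (lt_le_trans _ (plazy x)) // invr_gt0.
Qed.

(** A simple path has fewer than [#|V|] edges, and laziness pads it to length [#|V|]. *)
Lemma kpow_card_gt0 x y : 0 < kpow p #|V| x y.
Proof.
have [p0 _ _ _] := pP.
have /connectP[s es ->] := e_conn x y.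
case/shortenP: es => {}s es us _.
have ss : (size s <= #|V|)%N.
  by apply: leq_trans (leqnSn _) _; rewrite -[(size s).+1]/(size (x :: s));
     rewrite -(card_uniqP us) max_card.
rewrite -(subnK ss); apply: kpow_gt0_add.
elim: s x es {us ss} => [|z s IH] x /=; first by rewrite eqxx ltr01.
move=> /andP[xz zs]; rewrite (bigD1 z) //=.
rewrite ltr_wpDr ?sumr_ge0 //; first by move=> u _; rewrite mulr_ge0 ?kpow_ge0.
by rewrite mulr_gt0 // ?e_pos // IH.
Qed.

(* Doeblin's condition: all entries of the power [#|V|] are at least [w]. *)
Lemma mixing_time_exists (a : R) : 0 < a -> exists t, mixed_within a t.
Proof.
have dist01 (u v : R) : 0 <= u <= 1 -> 0 < v <= 1 -> `|u - v| <= 1.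
  by move=> /andP[u0 u1] /andP[v0 v1]; rewrite ler_norml; apply/andP; split; lra.
move=> a0; have [p0 _ _ _] := pP.
pose w := \prod_(u : V * V) kpow p #|V| u.1 u.2.
have w0 : 0 < w by apply: prodr_gt0 => u _; exact: kpow_card_gt0.
have wle x y : w <= kpow p #|V| x y.
  rewrite /w (bigD1 (x, y)) //= ler_piMr ?kpow_ge0 //.
  by apply: prodr_ile1 => u _; rewrite kpow_ge0 // kpow_le1.
have Nw x y : N * w <= 1.
  rewrite -[leRHS](kpow_sum pP #|V| x) mulr_natl -sumr_const.
  by apply: ler_sum => z _.
(* Subtracting [w] leaves a nonnegative kernel with row sums [1 - N * w]; the constant part vanishes
   against deviations whose columns sum to 0. *)
have contr k x y : `|kpow p (k * #|V|) x y - N^-1| <= (1 - N * w) ^+ k.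
  elim: k x y => [|k IH] x y.
    by rewrite mul0n expr0 dist01 ?kpow_ge0 ?kpow_le1 // invr_gt0 N_gt0
      invf_le1 // ler1n.
  have -> : kpow p (k.+1 * #|V|) x y - N^-1 =
     \sum_z (kpow p #|V| x z - w) * (kpow p (k * #|V|) z y - N^-1).
    under eq_bigr do rewrite mulrBl !mulrBr opprB.
    rewrite big_split sumrB /= mulSn kpowD // sumrB -!mulr_sumr -mulr_suml.
    rewrite kpow_sum // kpow_suml // sumr_const -[N^-1 *+ _]mulr_natl.
    by field; rewrite gt_eqF.
  apply: le_trans (ler_norm_sum _ _ _) _.
  apply: le_trans (_ : \sum_z (kpow p #|V| x z - w) * (1 - N * w) ^+ k <= _).
    apply: ler_sum => z _; rewrite normrM ger0_norm ?subr_ge0 //.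
    by rewrite ler_wpM2l // subr_ge0.
  by rewrite -mulr_suml sumrB kpow_sum // sumr_const -[w *+ _]mulr_natl exprS.
pose k := (Num.truncn (N / (a * (N * w)))).+1.
exists (k * #|V|)%N => x y; apply: le_trans (contr k x y) _.
have b0 : 0 < N * w by rewrite mulr_gt0.
apply: le_trans (_ : expR (- (N * w)) ^+ k <= _).
  rewrite lerXn2r ?nnegrE ?expR_ge0 ?subr_ge0 ?Nw //.
  exact: expR_ge1Dx.
rewrite -expRM_natl mulrN expRN -[leRHS]invrK lef_pV2 ?posrE ?expR_gt0 //;
  last by rewrite invr_gt0 divr_gt0.
rewrite invf_div; apply: le_trans (expR_ge1Dx _).
have : N / (a * (N * w)) <= k%:R by apply: ltW; exact: truncnS_gt.
rewrite invfM mulrA ler_pdivrMr // => /le_trans; apply.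
by rewrite lerDr.
Qed.

(** Maximum principle: at a maximum [z], the differences [mu z - mu x], weighted by the positive
    [kpow #|V| x z], sum to 0. It identifies the chosen [stationary]. *)
Lemma harmonic_const (mu : V -> R) :
  (forall y, \sum_x mu x * p x y = mu y) -> forall x y, mu x = mu y.
Proof.
move=> st; have stt t y : \sum_x mu x * kpow p t x y = mu y.
  elim: t y => [|t IH] y.
    by under eq_bigr do rewrite mulrC /= eq_sym; rewrite sum_delta.
  under eq_bigr do rewrite kpowSr // mulr_sumr.
  rewrite exchange_big /= -[RHS]st; apply: eq_bigr => z _.
  by rewrite -[in RHS]IH mulr_suml; apply: eq_bigr => x _; rewrite mulrA.
have [x0 _] : exists x : V, true by have /card_gt0P[x] := V_gt0; exists x.
case: (@Order.TotalTheory.arg_maxP _ _ _ x0 xpredT mu isT) => z _ zmax.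
suff h x : mu x = mu z by move=> x y; rewrite !h.
have s0 : \sum_x (mu z - mu x) * kpow p #|V| x z = 0.
  under eq_bigr do rewrite mulrBl.
  by rewrite sumrB -mulr_sumr kpow_suml // mulr1 stt subrr.
have := psumr_eq0P _ s0 => /(_ _ x isT) /eqP.
rewrite mulf_eq0 subr_eq0 (gt_eqF (kpow_card_gt0 x z)) orbF => h.
apply/eqP; rewrite eq_sym h // => y _.
by rewrite mulr_ge0 ?kpow_ge0 // subr_ge0; exact: zmax.
Qed.

End Mixing.

(** * The law of the walk, late points and the cover time *)

Local Open Scope classical_set_scope.
Local Open Scope ring_scope.

Section WalkLaw.
Variables (R : realType) (V : finType) (p : V -> V -> R).
Variables (d : measure_display) (Omega : measurableType d).
Variables (P : probability Omega R) (X : nat -> Omega -> V).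
Hypothesis Xm : forall t x, measurable [set w | X t w = x].
Hypothesis XP : forall t (v : nat -> V),
  P [set w | forall s, (s <= t)%N -> X s w = v s] =
  (#|V|%:R^-1 * \prod_(0 <= s < t) p (v s) (v s.+1))%:E.

Lemma measure_partition t (E : set Omega) : measurable E ->
  P E = (\sum_(y : V) P (E `&` [set w | X t w = y]))%E.
Proof.
move=> mE; rewrite (fsbig_seq _ _ (index_enum_uniq V)).
rewrite -measure_fin_bigcup.
- congr (P _); apply/seteqP; split => w.
    by move=> Ew; exists (X t w) => //=; rewrite mem_index_enum.
  by case=> y _ [].
- exact: finite_seq.
- by move=> x y _ _ [w /= [[_ <-] [_ <-]]].
- by move=> y _; exact: measurableI.
Qed.

Fixpoint visited (t : nat) (w : Omega) : {set V} :=
  if t is t'.+1 then (X t w |: visited t' w)%SET else [set X 0%N w]%SET.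

Fixpoint range_set (v : nat -> V) (t : nat) : {set V} :=
  if t is t'.+1 then (v t |: range_set v t')%SET else [set v 0%N]%SET.

Lemma measurable_fun_of_X t (Q : V -> Prop) : measurable [set w | Q (X t w)].
Proof.
rewrite (_ : [set _ | _] = \bigcup_(x in [set x | Q x]) [set w | X t w = x]).
  by apply: fin_bigcup_measurable => //; exact: finite_finset.
apply/seteqP; split => w /=; first by move=> Qw; exists (X t w).
by case=> x Qx /= ->.
Qed.

(** [Q] is general so that the induction can absorb the last position into it. *)
Lemma visited_measurable t (Q : V -> {set V} -> Prop) :
  measurable [set w | Q (X t w) (visited t w)].
Proof.
elim: t Q => [|t IH] Q; first exact: measurable_fun_of_X (fun x => Q x [set x]%SET).
rewrite (_ : [set _ | _] = \bigcup_(x in [set: V])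
    ([set w | X t.+1 w = x] `&` [set w | Q x (x |: visited t w)%SET])).
  apply: fin_bigcup_measurable; first exact: finite_finset.
  by move=> x _; apply: measurableI => //; exact: IH (fun _ W => Q x (x |: W)%SET).
apply/seteqP; split => w /=; first by move=> Qw; exists (X t.+1 w).
by case=> x _ /= [<-].
Qed.

Lemma cylinder_measurable t (v : nat -> V) :
  measurable [set w | forall s, (s <= t)%N -> X s w = v s].
Proof.
rewrite (_ : [set _ | _] = \bigcap_(s in `I_t.+1) [set w | X s w = v s]).
  by apply: fin_bigcap_measurable.
by apply/seteqP; split => w /= h s; exact: h.
Qed.

Lemma cylinder_visited t v w : (forall s, (s <= t)%N -> X s w = v s) ->
  visited t w = range_set v t.
Proof.
elim: t => [|t IH] h /=; first by rewrite h.
by rewrite h // IH // => s st; rewrite h // ltnW.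
Qed.

(** Markov property from cylinder probabilities alone: induction on the number [k] of remaining
    steps, the next vertex [y] being appended to the prescribed path. *)
Lemma cylinder_walk_exp (Q : V -> {set V} -> bool) k t v :
  P [set w | (forall s, (s <= t)%N -> X s w = v s) /\
             Q (X (k + t)%N w) (visited (k + t) w)] =
  (#|V|%:R^-1 * \prod_(0 <= s < t) p (v s) (v s.+1) *
   iter k (kstep p) (fun x W => (Q x W)%:R) (v t) (range_set v t))%:E.
Proof.
elim: k t v => [|k IH] t v.
  rewrite add0n /=; have [Qv|Qv] := boolP (Q (v t) (range_set v t)).
    rewrite mulr1 -XP; congr (P _); apply/seteqP; split => w /=; first by case.
    by move=> h; split=> //; rewrite (cylinder_visited h) h.
  rewrite mulr0 (_ : [set _ | _] = set0) ?measure0 //.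
  apply/seteqP; split => w //= [h]; rewrite (cylinder_visited h) h //.
  by rewrite (negPf Qv).
have mC : measurable [set w | (forall s, (s <= t)%N -> X s w = v s) /\
    Q (X (k.+1 + t)%N w) (visited (k.+1 + t) w)].
  apply: measurableI (cylinder_measurable t v) _.
  exact: visited_measurable (fun x W => is_true (Q x W)).
rewrite (measure_partition t.+1 mC) /= /kstep mulr_sumr -sumEFin.
apply: eq_bigr => y _.
pose v' s := if (s <= t)%N then v s else y.
have v'E s : (s <= t)%N -> v' s = v s by rewrite /v' => ->.
have v'y : v' t.+1 = y by rewrite /v' ltnn.
have rs s : (s <= t)%N -> range_set v' s = range_set v s.
  elim: s => [|s IHs] st /=; first by rewrite v'E.
  by rewrite v'E // IHs // ltnW.
have := IH t.+1 v'; rewrite addnS -addSn /= v'y rs //.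
rewrite big_nat_recr //= v'E // v'y.
rewrite (eq_big_nat _ _ (F2 := fun s => p (v s) (v s.+1))); last first.
  by move=> s /andP[_ st]; rewrite !v'E // ltnW.
rewrite !mulrA => <-; congr (P _); apply/seteqP; split => w /=.
  move=> [[h Qw] Xy]; split=> // s; rewrite leq_eqVlt => /predU1P[->|].
    by rewrite v'y.
  by rewrite ltnS => st; rewrite v'E // h.
move=> [h Qw]; split; last by rewrite h.
by split=> // s st; rewrite h ?v'E // ltnW.
Qed.

Lemma visited_walk_exp (Q : V -> {set V} -> bool) t :
  P [set w | Q (X t w) (visited t w)] =
  (walk_exp p t (fun x W => (Q x W)%:R))%:E.
Proof.
have mC := visited_measurable t (fun x W => is_true (Q x W)).
rewrite (measure_partition 0 mC) /walk_exp mulr_sumr -sumEFin.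
apply: eq_bigr => x _; have := cylinder_walk_exp Q t 0 (fun=> x).
rewrite addn0 big_geq //= mulr1 => <-; congr (P _); apply/seteqP.
split => w /=; first by move=> [Qw Xx]; split=> // s; rewrite leqn0 => /eqP->.
by move=> [h Qw]; split=> //; exact: h.
Qed.

End WalkLaw.

(** * The cover time as a series, and late points as survival *)

Section CoverTime.
Variables (R : realType) (G : sgraph) (p : G -> G -> R).
Variables (d : measure_display) (Omega : measurableType d).
Variables (P : probability Omega R) (X : nat -> Omega -> G).
Hypothesis Xm : forall t x, measurable [set w | X t w = x].
Hypothesis XP : forall t (v : nat -> G),
  P [set w | forall s, (s <= t)%N -> X s w = v s] =
  (#|G|%:R^-1 * \prod_(0 <= s < t) p (v s) (v s.+1))%:E.

Local Notation visited := (visited X).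

Lemma visitedP t w x :
  reflect (exists2 s, (s <= t)%N & X s w = x) (x \in visited t w).
Proof.
apply: (iffP idP).
  elim: t => [|t IH] /=; first by rewrite inE => /eqP->; exists 0%N.
  by rewrite !inE => /orP[/eqP->|/IH[s st <-]]; [exists t.+1|exists s => //; exact: ltnW].
case=> s; elim: t => [|t IH] /=; first by rewrite leqn0 => /eqP-> <-; rewrite inE.
rewrite leq_eqVlt => /predU1P[-> <-|]; first by rewrite !inE eqxx.
by rewrite ltnS => st /(IH st) h; rewrite !inE h orbT.
Qed.

Lemma coveredP t w :
  reflect (forall x, exists2 s, (s <= t)%N & X s w = x)
    (visited t w == [set: G]%SET).
Proof.
apply: (iffP eqP) => [vT x|h]; first by apply/visitedP; rewrite vT inE.
by apply/finset.setP => x; rewrite inE; apply/visitedP.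
Qed.

Definition uncovered_at t w : \bar R := (visited t w != [set: G]%SET)%:R%:E.

Lemma uncovered_at_ge0 t w : (0 <= uncovered_at t w)%E.
Proof. by rewrite lee_fin ler0n. Qed.

(** Tail-sum formula: the terms are 1 before the cover time and 0 from then on; both sides are
    infinite on paths that never cover. *)
Lemma cover_time_series w :
  cover_time R X w = (\sum_(0 <= t <oo) uncovered_at t w)%E.
Proof.
have u0 t : (0 <= uncovered_at t w)%E by exact: uncovered_at_ge0.
have mono s t : (s <= t)%N -> visited s w == [set: G]%SET ->
    visited t w == [set: G]%SET.
  move=> st /coveredP h; apply/coveredP => x.
  by have [r rs rx] := h x; exists r => //; exact: leq_trans st.
apply/eqP; rewrite eq_le; apply/andP; split.
  have [[t0 t0P]|no] := pselect (exists t, visited t w == [set: G]%SET).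
    have [t tP tmin] := ex_minnP (ex_intro (fun t => is_true _) t0 t0P).
    apply: le_trans (nneseries_lim_ge t _); last by [].
    rewrite (eq_big_nat _ _ (F2 := fun=> 1%E)); last first.
      move=> i /andP[_ it]; rewrite /uncovered_at.
      suff -> : visited i w != [set: G]%SET by [].
      by apply/negP => /tmin; rewrite leqNgt it.
    rewrite sumEFin big_const_nat subn0 iter_addr addr0.
    by apply: ereal_inf_lbound; exists t => //; exact/coveredP.
  suff -> : (\sum_(0 <= t <oo) uncovered_at t w = +oo)%E by exact: leey.
  apply: eq_infty => r; apply: le_trans (nneseries_lim_ge (Num.truncn r).+1 _) => //.
  rewrite (eq_big_nat _ _ (F2 := fun=> 1%E)); last first.
    move=> i _; rewrite /uncovered_at.
    suff -> : visited i w != [set: G]%SET by [].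
    by apply/negP => h; apply: no; exists i.
  rewrite sumEFin big_const_nat subn0 iter_addr addr0 lee_fin.
  by rewrite ltW // truncnS_gt.
apply: lime_le; first by apply: is_cvg_nneseries.
near=> n; apply: le_ereal_inf_tmp => _ [t tP <-].
have tC : visited t w == [set: G]%SET by exact/coveredP.
rewrite sumEFin lee_fin -natr_sum ler_nat.
apply: leq_trans (_ : \sum_(0 <= i < n) (i < t) <= _)%N.
  apply: leq_sum => i _; have [_|ti] := ltnP i t; first exact: leq_b1.
  by rewrite (mono _ _ ti tC).
elim: (n) => [|k IH]; first by rewrite big_geq.
rewrite big_nat_recr //=; have [kt|tk] := ltnP k t; last by rewrite addn0.
rewrite addn1; apply: leq_ltn_trans kt.
apply: leq_trans (_ : \sum_(0 <= i < k) 1 <= k)%N.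
  by apply: leq_sum => i _; exact: leq_b1.
by rewrite sum_nat_const_nat subn0 muln1.
Unshelve. all: by end_near.
Qed.

Lemma uncovered_at_measurable t : measurable_fun setT (uncovered_at t).
Proof.
rewrite (_ : uncovered_at t =
  fun w => (\1_[set w | visited t w != [set: G]%SET] w)%:E).
  apply/measurable_EFinP; apply: measurable_indic.
  exact: (visited_measurable Xm t (fun _ W => is_true (W != [set: G]%SET))).
apply/funext => w; rewrite /uncovered_at indicE; congr (_%:R%:E).
by congr nat_of_bool; apply/idP/idP; rewrite inE.
Qed.

Lemma integral_uncovered_at t :
  (\int[P]_w uncovered_at t w = (walk_exp p t (@uncovered R G))%:E)%E.
Proof.
have mU : measurable [set w | visited t w != [set: G]%SET].
  exact: (visited_measurable Xm t (fun _ W => is_true (W != [set: G]%SET))).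
rewrite -(visited_walk_exp Xm XP (fun _ W => W != [set: G]%SET)).
rewrite -[X in P X]setIT -integral_indic //; apply: eq_integral => w _.
rewrite /uncovered_at indicE; congr (_%:R%:E).
by congr nat_of_bool; apply/idP/idP; rewrite inE.
Qed.

Lemma Tcov_series :
  Tcov P X = (\sum_(0 <= t <oo) (walk_exp p t (@uncovered R G))%:E)%E.
Proof.
rewrite /Tcov; under eq_integral do rewrite cover_time_series.
rewrite integral_nneseries //.
- by apply: eq_eseriesr => t _; exact: integral_uncovered_at.
- exact: uncovered_at_measurable.
- by move=> *; exact: uncovered_at_ge0.
Qed.

(** With [Tcov_ge], this makes the expected cover time the supremum of the partial sums; its
    finiteness follows later from such a [b]. *)
Lemma Tcov_le (b : R) :
  (forall n, \sum_(t < n) walk_exp p t (@uncovered R G) <= b) ->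
  (Tcov P X <= b%:E)%E.
Proof.
move=> h; rewrite Tcov_series; apply: lime_le.
  apply: is_cvg_nneseries => t _ _; rewrite -integral_uncovered_at.
  by apply: integral_ge0 => w _; exact: uncovered_at_ge0.
by near=> n; rewrite sumEFin lee_fin big_mkord.
Unshelve. all: by end_near.
Qed.

Lemma Tcov_ge n :
  ((\sum_(t < n) walk_exp p t (@uncovered R G))%:E <= Tcov P X)%E.
Proof.
rewrite Tcov_series; apply: le_trans (nneseries_lim_ge n _).
  by rewrite sumEFin lee_fin big_mkord.
move=> t _ _; rewrite -integral_uncovered_at.
by apply: integral_ge0 => w _; exact: uncovered_at_ge0.
Qed.

Hypothesis pP : lazy_symmetric p.

(** Hitting times are integers or infinite, and [k] is the last integer strictly below [alpha * c]:
    a point is late exactly when it is unvisited through time [k]. *)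
Lemma late_points_msurv (alpha c : R) l (x : 'I_l -> G) k :
  Tcov P X = c%:E -> k%:R < alpha * c <= k.+1%:R ->
  P [set w | forall i, late_points P X alpha w (x i)] =
  (msurv p [set x i | i : 'I_l]%SET k)%:E.
Proof.
move=> cE /andP[kb bk].
rewrite -walk_exp_avoid // -(visited_walk_exp Xm XP
  (fun _ W => [disjoint W & [set x i | i : 'I_l]%SET]%B)).
congr (P _); apply/seteqP; split => w /=.
  move=> h; rewrite disjoint_sym disjoint_subset; apply/fintype.subsetP => y.
  move=> /imsetP[i _ ->]; rewrite !inE; apply/negP => /visitedP[s sk sx].
  have h1 : (alpha%:E * Tcov P X <= hitting_time R X (x i) w)%E := h i.
  have h2 : (hitting_time R X (x i) w <= s%:R%:E)%E.
    by apply: ereal_inf_lbound; exists s.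
  have := le_trans h1 h2; rewrite cE lee_fin; apply/negP; rewrite -ltNge.
  by apply: le_lt_trans kb; rewrite ler_nat.
move=> dj i; rewrite /late_points /= cE; apply: le_ereal_inf_tmp => _ [s sx <-].
rewrite lee_fin; apply: le_trans bk _; rewrite ler_nat ltnNge.
apply/negP => sk; move: dj; rewrite disjoint_subset => /fintype.subsetP/(_ (x i)).
rewrite !inE => /(_ _)/negP; apply; first by apply/visitedP; exists s.
by apply/imsetP; exists i.
Qed.

End CoverTime.

(** * Vertex transitive graphs *)

Section Distance.
Variable G : sgraph.
Hypothesis G_conn : connected_graph G.
Implicit Types x y z : G.

(** Connectivity makes the minimum in [dist] attained, rather than the default 0. *)
Lemma dist_path x y :
  exists p, [/\ path (@adj G) x p, last x p = y & size p = dist x y].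
Proof.
have /connectP[p ep ly] := G_conn.2 x y.
have [] := @nat_minP [set k | exists p : seq G,
    [/\ path (@adj G) x p, last x p = y & size p = k]] _; last by [].
by exists (size p), p.
Qed.

Lemma dist_le x p : path (@adj G) x p -> (dist x (last x p) <= size p)%N.
Proof.
move=> ep.
have [] := @nat_minP [set k | exists q : seq G,
    [/\ path (@adj G) x q, last x q = last x p & size q = k]] _.
  by exists (size p), p.
by move=> _; apply; exists p.
Qed.

Lemma dist_eq0 x y : (dist x y == 0%N) = (x == y).
Proof.
apply/eqP/eqP => [d0|<-]; last by apply/eqP; rewrite -leqn0 (dist_le (p := [::])).
have [p [ep lp]] := dist_path x y; rewrite d0 => /size0nil p0.
by rewrite -lp p0.
Qed.

Lemma distxx x : dist x x = 0%N.
Proof. by apply/eqP; rewrite dist_eq0. Qed.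

Lemma dist_adj x y : adj x y -> (dist x y <= 1)%N.
Proof. by move=> xy; apply: (@dist_le x [:: y]); rewrite /= xy. Qed.

Lemma dist_triangle x y z : (dist x z <= dist x y + dist y z)%N.
Proof.
have [p [ep lp <-]] := dist_path x y; have [q [eq lq <-]] := dist_path y z.
rewrite -size_cat -lq -lp -last_cat; apply: dist_le.
by rewrite cat_path ep lp.
Qed.

Lemma dist_sym_le x y : (dist y x <= dist x y)%N.
Proof.
have [p [ep lp <-]] := dist_path x y.
have := rev_path (@adj G) x p.
rewrite (eq_path (e' := @adj G)) => [|u v]; last exact: adj_sym.
rewrite ep lp => e; have lx : last y (rev (belast x p)) = x.
  by case: (p) lp => [/= <-|u q] //= _; rewrite rev_cons last_rcons.
by have := dist_le e; rewrite size_rev size_belast lx.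
Qed.

Lemma dist_sym x y : dist x y = dist y x.
Proof. by apply/eqP; rewrite eqn_leq !dist_sym_le. Qed.

Lemma dist_set1 x y : dist_set x [set y]%SET = dist x y.
Proof.
have [] := @nat_minP [set dist x z | z in [set` [set y]%SET]] _.
  by exists (dist x y), y => //=; rewrite inE.
by rewrite -/(dist_set x [set y]%SET) => -[z /=]; rewrite inE => /eqP-> ->.
Qed.

Lemma diam1 y : diam [set y]%SET = 0%N.
Proof. by rewrite /diam !big_set1 distxx. Qed.

End Distance.

Section GraphWalk.
Variables (R : realType) (G : sgraph).
Hypothesis G_conn : connected_graph G.
Hypothesis G_trans : vertex_transitive G.
Implicit Types x y z : G.

Local Notation K := (@lazy_kernel R G).
Local Notation N := (#|G|%:R : R).
Local Notation T := (Tmix R G).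

Let G_gt0 : (0 < #|G|)%N. Proof. by case: G_conn. Qed.

Lemma deg_aut (f : {perm G}) x :
  (forall u v, adj (f u) (f v) = adj u v) -> deg (f x) = deg x.
Proof.
move=> fP; rewrite /deg -[RHS](card_imset _ (@perm_inj _ f)); congr #|pred_of_set _|.
apply/finset.setP => y; apply/idP/imsetP => [|[z]]; rewrite inE => fxy.
  by exists (f^-1%g y); rewrite ?permKV // inE -fP permKV.
by move=> ->; rewrite inE fP.
Qed.

Lemma deg_const x y : deg x = deg y.
Proof. by have [f [fP <-]] := G_trans x y; rewrite deg_aut. Qed.

Lemma lazy_kernel_symmetric : lazy_symmetric K.
Proof.
have K0 x y : 0 <= K x y.
  rewrite /lazy_kernel; case: ifP => _; first by case: ifP.
  by case: ifP => _ //; rewrite invr_ge0 mulr_ge0.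
split=> //.
- move=> x y; rewrite /lazy_kernel eq_sym adj_sym (deg_const x y).
  by have [->|//] := eqVneq y x.
- move=> x; rewrite (bigD1 x) //= /lazy_kernel eqxx.
  rewrite (eq_bigr (fun y => if adj x y then (2 * (deg x)%:R)^-1 else 0));
    last by move=> y /negPf; rewrite eq_sym => ->.
  rewrite -big_mkcondr (eq_bigl [in [set y | adj x y]%SET]); last first.
    move=> y; rewrite inE; case: (eqVneq y x) => [->|//].
    by rewrite adj_irr.
  rewrite sumr_const -/(deg x) -[_^-1 *+ _]mulr_natl.
  (* In degree 0 the holding probability is 1 by definition. *)
  have [->|d0] := eqVneq (deg x) 0%N; first by rewrite mul0r addr0.
  by field; rewrite pnatr_eq0.
- by move=> x; rewrite /lazy_kernel eqxx; case: ifP => // _; rewrite invf_le1 // ler1n.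
Qed.

Local Notation KP := lazy_kernel_symmetric.

Lemma lazy_kernel_iterE t x y : lazy_kernel_iter R t x y = kpow K t x y.
Proof. by elim: t x => [|t IH] x //=; apply: eq_bigr => z _; rewrite IH. Qed.

Lemma kpow_aut (f : {perm G}) t x y :
  (forall u v, adj (f u) (f v) = adj u v) ->
  kpow K t (f x) (f y) = kpow K t x y.
Proof.
move=> fP; have KE u v : K (f u) (f v) = K u v.
  by rewrite /lazy_kernel (inj_eq perm_inj) fP deg_aut.
elim: t x => [|t IH] x /=; first by rewrite (inj_eq perm_inj).
rewrite (reindex_inj (@perm_inj _ f)) /=; apply: eq_bigr => z _.
by rewrite KE IH.
Qed.

Lemma kpow_diag t x y : kpow K t x x = kpow K t y y.
Proof. by have [f [fP <-]] := G_trans x y; rewrite kpow_aut. Qed.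

Lemma adj_kernel_gt0 x y : adj x y -> 0 < K x y.
Proof.
move=> xy; rewrite /lazy_kernel xy; have [xy'|_] := eqVneq x y.
  by rewrite xy' adj_irr in xy.
rewrite invr_gt0 mulr_gt0 // ltr0n; apply/card_gt0P; exists y.
by rewrite inE.
Qed.

Lemma stationaryE x : stationary R x = N^-1.
Proof.
rewrite /stationary; case: xgetP => [mu _ [mu0 mu1 muK]|noU]; last first.
  case: (noU (fun=> N^-1)); split.
  - by move=> y; rewrite invr_ge0.
  - by rewrite sumr_const -[_ *+ _]mulr_natl mulfV // pnatr_eq0 -lt0n.
  - move=> y; rewrite -mulr_sumr; have [_ Ks K1 _] := KP.
    by under eq_bigr do rewrite Ks; rewrite K1 mulr1.
have c := harmonic_const KP G_gt0 G_conn.2 adj_kernel_gt0 muK.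
move: mu1; rewrite (eq_bigr (fun=> mu x)) => [|y _]; last exact: c.
rewrite sumr_const -[_ *+ _]mulr_natl => h.
have N0 : N != 0 by rewrite pnatr_eq0 -lt0n.
by apply: (mulfI N0); rewrite h mulfV.
Qed.

(** [mixing_time_exists] rules out the default value of [nat_min]. *)
Lemma Tmix_mixed : mixed_within K 4^-1 T.
Proof.
have N0 : 0 < N by rewrite ltr0n.
have e t x y : (`|lazy_kernel_iter R t x y / stationary R y - 1| <= 4^-1) =
    (`|kpow K t x y - N^-1| <= 4^-1 / N).
  rewrite stationaryE lazy_kernel_iterE invrK ler_pdivlMr //.
  have -> : kpow K t x y * N - 1 = (kpow K t x y - N^-1) * N.
    by rewrite mulrBl mulVf ?gt_eqF.
  by rewrite normrM (gtr0_norm N0).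
have [] := @nat_minP [set t | forall x y,
    `|lazy_kernel_iter R t x y / stationary R y - 1| <= 4^-1] _.
  have i4 : 0 < 4^-1 :> R by rewrite invr_gt0.
  have [t tP] := mixing_time_exists KP G_gt0 G_conn.2 adj_kernel_gt0 i4.
  by exists t => x y; rewrite e.
by rewrite -/(Tmix R G) => h _ x y; rewrite -e; exact: h.
Qed.

(** At time 0 an off-diagonal entry misses [1 / N] entirely. Positivity lets [gamma] count the visit
    at time 0, whence [1 <= gamma]. *)
Lemma Tmix_gt0 : (1 < #|G|)%N -> (0 < T)%N.
Proof.
move=> G1; rewrite lt0n; apply/eqP => T0; have := Tmix_mixed; rewrite T0.
have [x _] : exists x : G, true by have /card_gt0P[x] := G_gt0; exists x.
have [y xy] : exists y, y != x.
  apply/existsP; rewrite -negb_forall; apply/negP => /forallP h.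
  move: G1; rewrite ltnNge => /negP; apply; rewrite -(cards1 x).
  apply/subset_leq_card/fintype.subsetP => u _.
  by rewrite inE; exact: h u.
move=> /(_ y x); rewrite /= (negPf xy) sub0r normrN ger0_norm ?invr_ge0 //.
rewrite ler_pdivlMr ?ltr0n // mulVf ?pnatr_eq0 -?lt0n //.
by rewrite leNgt invf_lt1 // ltr1n.
Qed.

Lemma greenE x y : green R x y = occ K T.+1 x y.
Proof.
rewrite /green /occ big_mkord; apply: eq_bigr => t _.
exact: lazy_kernel_iterE.
Qed.

Lemma green_sym x y : green R x y = green R y x.
Proof. by rewrite !greenE occ_sym //; exact: KP. Qed.

(** After the mixing time every entry is at most [(1 + 1 / 4) / N <= 2 / N]. *)
Lemma occ_le_green M x y : occ K M x y <= green R x y + 2 * M%:R / N.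
Proof.
apply: le_trans (_ : occ K (T.+1 + M) x y <= _).
  rewrite addnC /occ big_split_ord /= lerDl sumr_ge0 // => t _; apply: kpow_ge0; exact: KP.
rewrite greenE /occ big_split_ord /= lerD2l.
have N0 : 0 < N by rewrite ltr0n.
apply: le_trans (_ : \sum_(s < M) (2 / N) <= _); last first.
  rewrite sumr_const card_ord -[_ *+ _]mulr_natl le_eqVlt.
  by apply/orP; left; apply/eqP; ring.
apply: ler_sum => s _.
rewrite -[leLHS]/(kpow K (T + s).+1 x y) -addnS addnC.
apply: le_trans (kpow_le_after KP s.+1 x y Tmix_mixed) _.
by rewrite ler_wpM2r ?invr_ge0 ?ler0n //; lra.
Qed.

Lemma graph_nearly_mixed (eta : R) k x :
  (1 < #|G|)%N -> 4^-1 ^+ k.+1 <= eta -> (k.+1 * T)%:R <= eta * N ->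
  nearly_mixed K eta (occ K (k.+1 * T) x x) (k.+1 * T).
Proof.
move=> G1 ke Me; have T0 := Tmix_gt0 G1.
have N0 : 0 < N by rewrite ltr0n.
split=> //.
- move=> u v; have i4 : 0 <= 4^-1 :> R by rewrite invr_ge0.
  have := mixed_withinM KP G_gt0 k i4 Tmix_mixed u v.
  move=> /le_trans /(_ (_ : _ <= eta / N)).
  rewrite ler_wpM2r ?invr_ge0 ?(ltW N0) // => /(_ isT).
  rewrite ler_norml mulrBl mulrDl !mul1r lerBrDr lerBlDr => /andP[h1 h2].
  by rewrite addrC h1 addrC h2.
- by move=> y; apply: eq_bigr => t _; exact: kpow_diag.
- case: (k.+1 * T)%N (muln_gt0 k.+1 T) => [|M _]; first by rewrite T0.
  rewrite /occ big_ord_recl /= eqxx lerDl sumr_ge0 // => t _.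
  exact: (kpow_ge0 KP t.+1 x x).
Qed.

End GraphWalk.

Section GreenBounds.
Variables (R : realType) (G : sgraph) (rho : R -> R -> R).
Hypothesis G_conn : connected_graph G.
Hypothesis G_trans : vertex_transitive G.
Hypothesis rhoP : transience_function rho.
Hypothesis green_rho : forall (x : G) (A : {set G}),
  green_set R x A <= rho (dist_set x A)%:R (diam A)%:R.
Implicit Types x y z : G.

Local Notation N := (#|G|%:R : R).

Lemma green_le_rho r x y : 0 <= r -> r <= (dist x y)%:R ->
  green R x y <= rho r 0.
Proof.
move=> r0 rd; have := green_rho x [set y]%SET.
rewrite /green_set big_set1 dist_set1 // diam1 // => /le_trans; apply.
by case: rhoP => _ mono _; exact: mono.
Qed.

Lemma deg_gt0 x : (1 < #|G|)%N -> (0 < deg x)%N.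
Proof.
move=> G1; have [y yx] : exists y, y != x.
  apply/existsP; rewrite -negb_forall; apply/negP => /forallP h.
  move: G1; rewrite ltnNge => /negP; apply; rewrite -(cards1 x).
  apply/subset_leq_card/fintype.subsetP => u _.
  by rewrite inE; exact: h u.
have /connectP[[|z p] /=] := G_conn.2 x y; first by move=> _ e; rewrite e eqxx in yx.
by move=> /andP[xz _] _; apply/card_gt0P; exists z; rewrite inE.
Qed.

Lemma maxdegE x : maxdeg G = deg x.
Proof.
apply/eqP; rewrite eqn_leq leq_bigmax andbT.
by apply/bigmax_leqP => y _; rewrite (deg_const G_trans y x).
Qed.

(* Off the diagonal, the first jump is uniform over the neighbours of [x], and
   the Green function of [y] summed over this set of diameter at most 2 is
   bounded. *)
Lemma green_le_deg x y : (1 < #|G|)%N -> x != y ->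
  green R x y <= (rho 0 0 + rho 0 1 + rho 0 2) / (maxdeg G)%:R.
Proof.
move=> G1 xy; have KP := lazy_kernel_symmetric R G_trans.
have d0 : 0 < (deg x)%:R :> R by rewrite ltr0n deg_gt0.
rewrite (maxdegE x).
pose B := [set z | adj x z]%SET.
have gB : green_set R y B <= rho 0 0 + rho 0 1 + rho 0 2.
  have [rho0 mono _] := rhoP.
  have dB : (diam B <= 2)%N.
    apply/bigmax_leqP => u; rewrite inE => xu; apply/bigmax_leqP => v.
    rewrite inE => xv; apply: leq_trans (dist_triangle G_conn u x v) _.
    rewrite (dist_sym G_conn u x).
    exact: leq_add (dist_adj xu) (dist_adj xv).
  apply: le_trans (green_rho y B) _.
  (* Nothing relates the values of [rho] at different diameters, so those at 0, 1 and 2 are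
     summed. *)
  apply: le_trans (_ : rho 0 (diam B)%:R <= _); first exact: mono.
  have r0 := rho0 0 0 (lexx _) (lexx _); have r1 := rho0 0 1 (lexx _) ler01.
  have r2 := rho0 0 2 (lexx _) (ler0n _ _).
  case: (diam B) dB => [|[|[|//]]] _; lra.
have k0 := kpow_ge0 KP (Tmix R G).+1 x y.
have := occ_step (@lazy_kernel R G) (Tmix R G).+1 x y.
move: k0; move: (kpow _ _ x y) => kp k0.
rewrite (negPf xy) subr0 -!greenE.
rewrite (bigD1 x) //= -greenE.
rewrite {1}/lazy_kernel eqxx (gtn_eqF (deg_gt0 x G1)).
have -> : \sum_(z | z != x) lazy_kernel R x z * occ (@lazy_kernel R G) (Tmix R G).+1 z y =
    (2 * (deg x)%:R)^-1 * green_set R y B.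
  rewrite /green_set mulr_sumr big_mkcond [RHS]big_mkcond.
  apply: eq_bigr => z _; rewrite inE -greenE green_sym // /lazy_kernel eq_sym.
  have [<-|_] := eqVneq x z; first by rewrite adj_irr.
  by case: ifP => // _; rewrite mul0r.
move=> h; rewrite ler_pdivlMr //.
have : (2 * (deg x)%:R) * (2^-1 * green R x y) <= green_set R y B.
  rewrite -ler_pdivlMl ?mulr_gt0 //; move: h k0; lra.
lra.
Qed.

(* A maximal [r]-separated set: the balls of radius [r] around it cover. *)
Lemma separated_set_exists (kappa r : R) : (0 < #|G|)%N -> 0 <= r ->
  (forall x, ln #|ball_graph x r|%:R <= kappa * ln N) ->
  exists S : {set G},
    (forall x y, x \in S -> y \in S -> x != y -> r < (dist x y)%:R) /\
    (1 - kappa) * ln N <= ln #|S|%:R.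
Proof.
move=> G0 r0 ballN; have N0 : 0 < N by rewrite ltr0n.
pose sep (S : {set G}) := [forall x in S, forall y in S,
  (x != y) ==> (r < (dist x y)%:R)].
have sepP S : sep S ->
    forall x y, x \in S -> y \in S -> x != y -> r < (dist x y)%:R.
  by move=> /forall_inP h x y xS yS; exact/implyP/(forall_inP (h x xS)).
have sep0 : sep finset.set0 by apply/forall_inP => x; rewrite inE.
case: (@arg_maxnP _ finset.set0 sep (fun S => #|S|) sep0) => S Ssep Smax.
exists S; split; first exact: sepP.
have cover x : exists2 y, y \in S & (dist y x)%:R <= r.
  have [xS|xS] := boolP (x \in S); first by exists x; rewrite ?distxx.
  have [[y yS yr]|no] := pselect (exists2 y, y \in S & (dist y x)%:R <= r).
    by exists y.
  have far y : y \in S -> r < (dist y x)%:R.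
    by move=> yS; rewrite ltNge; apply/negP => yr; apply: no; exists y.
  suff /Smax : sep (x |: S)%SET.
    by rewrite /= cardsU1 xS add1n => /(leq_trans (ltnSn _)); rewrite ltnn.
  apply/forall_inP => y yxS; apply/forall_inP => z zxS; apply/implyP => yz.
  move: yxS zxS; rewrite !inE => /predU1P[yx|yS] /predU1P[zx|zS].
  - by rewrite yx zx eqxx in yz.
  - by rewrite yx dist_sym // far.
  - by rewrite zx far.
  - exact: (sepP _ Ssep).
have ballS : (#|G| <= \sum_(y in S) #|ball_graph y r|)%N.
  rewrite -sum1_card; apply: leq_trans
    (_ : \sum_(x : G) \sum_(y in S) (x \in ball_graph y r) <= _)%N.
    apply: leq_sum => x _; have [y yS yr] := cover x.
    by rewrite (bigD1 y) //= inE yr.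
  rewrite exchange_big /=; apply: leq_sum => y _.
  by rewrite -sum1_card [leqRHS]big_mkcond.
have NS : N <= #|S|%:R * expR (kappa * ln N).
  apply: le_trans (_ : (\sum_(y in S) #|ball_graph y r|)%:R <= _).
    by rewrite ler_nat.
  rewrite mulr_natl -sumr_const natr_sum; apply: ler_sum => y _.
  have b0 : 0 < #|ball_graph y r|%:R :> R.
    by rewrite ltr0n; apply/card_gt0P; exists y; rewrite inE distxx.
  by rewrite -[leLHS](lnK b0) ler_expR.
have S0 : 0 < #|S|%:R :> R.
  rewrite ltr0n lt0n; apply/eqP => S0; move: NS; rewrite S0 mul0r.
  by rewrite leNgt N0.
have := NS; rewrite -ler_ln ?posrE ?mulr_gt0 ?expR_gt0 //.
rewrite lnM ?posrE ?expR_gt0 // expRK; lra.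
Qed.

End GreenBounds.

(** For each [u] one vertex [y] is exempt from smallness, since [u] may be near or equal to a point
    of the family; there [occ] is bounded by [gamma]. *)
Lemma late_bounds_of_graph (R : realType) (alpha eps : R) (l : nat) :
  0 < alpha < 1 -> 0 < eps -> (0 < l)%N ->
  exists kappa B : R, 0 < kappa /\
  forall (G : sgraph) (d : measure_display) (Omega : measurableType d)
    (P : probability Omega R) (X : nat -> Omega -> G) (x : 'I_l -> G)
    (S : {set G}),
    connected_graph G -> vertex_transitive G -> stationary_lazy_walk P X ->
    B <= #|G|%:R -> (Tmix R G)%:R <= kappa * #|G|%:R ->
    injective x ->
    (forall u, exists y, forall i, x i != y -> green R u (x i) <= kappa) ->
    (forall u v, u \in S -> v \in S -> u != v -> green R u v <= kappa) ->
    (1 - kappa) * ln #|G|%:R <= ln #|S|%:R ->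
    late_bounds #|G| l alpha eps
      (P [set w | forall i, late_points P X alpha w (x i)]).
Proof.
move=> alpha01 eps0 l0.
have [eta [B [e0 e6 core]]] := late_asymptotics alpha01 eps0 l0.
have i0 : 0 < eta^-1 by rewrite invr_gt0.
pose k := Num.truncn eta^-1.
have ke : 4^-1 ^+ k.+1 <= eta.
  rewrite exprVn -[leRHS]invrK lef_pV2 ?posrE ?exprn_gt0 //.
  apply: le_trans (ltW (truncnS_gt _)) _; rewrite -/k -natrX ler_nat.
  exact: ltnW (ltn_expl _ _).
have lR : 1 <= l%:R :> R by rewrite ler1n.
have k0 : 0 <= k%:R :> R by exact: ler0n.
(* A non-exempt occupation is at most [kappa] from Green's function plus [2 * (k + 1) * kappa] from
   later times; [l] of these must add up to [eta]. *)
pose q : R := l%:R * (2 * k%:R + 3).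
have q0 : 0 < q by rewrite mulr_gt0 //; lra.
have q1 : 2 * k%:R + 3 <= q.
  by rewrite /q -[leLHS]mul1r ler_wpM2r //; lra.
pose kappa := eta / q.
have ka0 : 0 < kappa by rewrite divr_gt0.
have kq : kappa * q = eta by rewrite /kappa divfK // gt_eqF.
have kk : kappa * (2 * k%:R + 3) <= eta by rewrite -[leRHS]kq ler_wpM2l // ltW.
(* [exp 4] gives [ln N >= 4], which makes the lower bound on the expected cover time positive. *)
exists kappa, (Num.max (expR B) (expR 4)); split=> //.
move=> G d Omega P X x S Gc Gt [Xm XP] BG TG xinj xgreen Sgreen lnS.
have KP := lazy_kernel_symmetric R Gt; set K := @lazy_kernel R G in KP.
move: BG; rewrite ge_max => /andP[BG G4].
have N0 : 0 < #|G|%:R :> R by apply: lt_le_trans G4; exact: expR_gt0.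
have BL : B <= ln #|G|%:R by rewrite -ler_expR lnK.
have L4 : 4 <= ln #|G|%:R :> R by rewrite -ler_expR lnK.
have G0 : (0 < #|G|)%N by rewrite -(ltr0n R).
have G1 : (1 < #|G|)%N.
  rewrite -(ltr1n R); apply: lt_le_trans G4.
  by apply: lt_le_trans (expR_ge1Dx 4); lra.
pose M := (k.+1 * Tmix R G)%N; set N : R := #|G|%:R in N0 BL L4 TG lnS *.
have [x0 _] : exists u : G, true by have /card_gt0P[u] := G0; exists u.
have MN1 : M%:R <= (k%:R + 1) * kappa * N.
  by rewrite natrM -natr1 -mulrA ler_wpM2l // addr_ge0.
have ek : (k%:R + 1) * kappa <= eta.
  have : 0 <= kappa * (k%:R + 2) by rewrite mulr_ge0 ?(ltW ka0) //; lra.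
  lra.
have MN : M%:R <= eta * N.
  by apply: le_trans MN1 _; rewrite ler_wpM2r // ltW.
have occ_gr u v : occ K M u v <= green R u v + 2 * ((k%:R + 1) * kappa).
  apply: le_trans (occ_le_green R Gc Gt M u v) _; rewrite lerD2l.
  rewrite ler_pdivrMr // -[leRHS]mulrA ler_wpM2l //.
have mix := graph_nearly_mixed Gc Gt x0 G1 ke MN.
rewrite -/M -/K in mix; set gamma := occ K M x0 x0 in mix.
pose A := [set x i | i : 'I_l]%SET.
have Al : #|A| = l by rewrite card_imset // card_ord.
have XP' t (v : nat -> G) : P [set w | forall s, (s <= t)%N -> X s w = v s] =
    (#|G|%:R^-1 * \prod_(0 <= s < t) K (v s) (v s.+1))%:E.
  by rewrite XP stationaryE.
pose ub := N * gamma * ((1 + 6 * eta) * ln N + 4 + 3 / eta).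
have sum_ub n : \sum_(t < n) walk_exp K t (@uncovered R G) <= ub.
  exact: (sum_uncovered_le KP mix e0 e6 G0 n).
have Tub : (Tcov P X <= ub%:E)%E by exact: (Tcov_le Xm XP').
have T0 : (0 <= Tcov P X)%E.
  by have := Tcov_ge Xm XP' 0; rewrite big_ord0.
have Tfin : Tcov P X \is a fin_num.
  by rewrite ge0_fin_numE // (le_lt_trans Tub) // ltry.
pose c := fine (Tcov P X); have cE : Tcov P X = c%:E by rewrite fineK.
have sumc n : \sum_(t < n) walk_exp K t (@uncovered R G) <= c.
  by rewrite -lee_fin -cE; exact: (Tcov_ge Xm XP').
have cmin b : (forall n, \sum_(t < n) walk_exp K t (@uncovered R G) <= b) ->
    c <= b.
  by move=> h; rewrite -lee_fin -cE; exact: (Tcov_le Xm XP').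
have kkeq : 2 * ((k%:R + 1) * kappa) + kappa = kappa * (2 * k%:R + 3) by ring.
have occS u v : u \in S -> v \in S -> u != v -> occ K M u v <= eta.
  move=> uS vS uv; apply: le_trans (occ_gr u v) _.
  have := Sgreen u v uS vS uv; lra.
have lnS' : (1 - eta) * ln N <= ln #|S|%:R.
  apply: le_trans lnS; rewrite ler_wpM2r //; first by lra.
  have : 0 <= kappa * (2 * k%:R + 2) by rewrite mulr_ge0 ?(ltW ka0) //; lra.
  lra.
have occA u : \sum_(y in A) occ K M u y <= gamma + eta.
  have [y0 y0P] := xgreen u.
  have small y : y \in A -> y != y0 -> occ K M u y <= kappa * (2 * k%:R + 3).
    move=> /imsetP[i _ ->] xy; apply: le_trans (occ_gr u _) _.
    have := y0P i xy; lra.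
  have sumA : \sum_(y in A | y != y0) occ K M u y <= eta.
    apply: le_trans (_ : \sum_(y in A) kappa * (2 * k%:R + 3) <= _).
      rewrite big_mkcondr; apply: ler_sum => y yA; case: ifP => [|_].
        exact: small.
      by rewrite mulr_ge0 ?(ltW ka0) //; lra.
    rewrite sumr_const Al -[_ *+ _]mulr_natl mulrCA -/q kq.
    exact: lexx.
  have [yA|yA] := boolP (y0 \in A).
    by rewrite (bigD1 y0) //= lerD // (occ_le_gamma KP mix).
  have -> : \sum_(y in A) occ K M u y = \sum_(y in A | y != y0) occ K M u y.
    apply: eq_bigl => y; have [->|_] := eqVneq y y0; rewrite ?andbT // andbF.
    by rewrite (negPf yA).
  apply: le_trans sumA _; rewrite lerDr; exact: (occ_ge0 KP).
have c_gt0 : 0 < c.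
  apply: lt_le_trans (sum_uncovered_ge KP mix e0 e6 G0 lnS' occS sumc).
  have [_ _ _ g1] := mix.
  rewrite -/N; apply: mulr_gt0; first by rewrite mulr_gt0 // (lt_le_trans ltr01).
  have : 0 <= (6^-1 - eta) * ln N by rewrite mulr_ge0 //; lra.
  lra.
(* The left inequality is strict: if [alpha * c] is an integer, its predecessor is taken. *)
have [j jP] : exists j : nat, j%:R < alpha * c <= j.+1%:R.
  have b0 : 0 < alpha * c by case/andP: alpha01 => a0 _; rewrite mulr_gt0.
  have /andP[j1 j2] := truncn_itv (ltW b0).
  case: (Num.truncn _) j1 j2 => [|j] j1 j2.
    by exists 0%N; rewrite b0 ltW.
  move: j1; rewrite le_eqVlt => /predU1P[je|jl].
    by exists j; rewrite -je ltr_nat ltnSn lexx.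
  by exists j.+1; rewrite jl ltW.
rewrite (late_points_msurv Xm XP' x cE jP) -/A.
have /andP[lo hi] := core G K gamma c M j A S KP mix G0 BL Al occA lnS' occS
  sumc cmin jP.
have powE (b : R) : N `^ b = expR (b * ln N) by rewrite /powR gt_eqF.
split; rewrite lee_fin powE.
  apply: le_trans lo; rewrite ler_piMl ?expR_ge0 //; lra.
by apply: le_trans hi _; rewrite ler_peMl ?expR_ge0 //; lra.
Qed.

(** * Error rates *)

(** Being late means avoiding the point at each integer time below [alpha * Tcov], a countable
    intersection. Measurability yields the bound of the probability by 1. *)
Lemma late_event_measurable (R : realType) (G : sgraph) (d : measure_display)
    (Omega : measurableType d) (P : probability Omega R)
    (X : nat -> Omega -> G) (alpha : R) (l : nat) (x : 'I_l -> G) :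
  (forall t y, measurable [set w | X t w = y]) ->
  measurable [set w | forall i, late_points P X alpha w (x i)].
Proof.
move=> Xm; set b := (alpha%:E * Tcov P X)%E.
rewrite (_ : [set _ | _] = \bigcap_(i in [set: 'I_l]) \bigcap_t
    (if (b <= t%:R%:E)%E then setT else ~` [set w | X t w = x i])).
  apply: fin_bigcap_measurable => // i _; apply: bigcapT_measurable => t.
  by case: ifP => // _; exact: measurableC.
apply/seteqP; split => w /=.
  move=> h i _ t _; case: ifPn => // /negP bt /= Xt; apply: bt.
  by apply: le_trans (h i) _; apply: ereal_inf_lbound; exists t.
move=> h i; apply: le_ereal_inf_tmp => _ [t Xt <-].
by have := h i I t I; case: ifPn => // _ /(_ Xt).
Qed.

Section LateBounds.
Variables (R : realType) (N l : nat) (alpha : R) (p : \bar R).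
Hypothesis N_gt0 : (0 < N)%N.
Hypothesis p_ge0 : (0 <= p)%E.

Let N_ge1 : 1 <= N%:R :> R. Proof. by rewrite ler1n. Qed.

Lemma late_bounds_le (e1 e2 : R) : 0 <= e1 -> e1 <= e2 ->
  late_bounds N l alpha e1 p -> late_bounds N l alpha e2 p.
Proof.
move=> e0 e12 [lo hi]; split.
  have [e21|e21] := leP (1 - e2) 0.
    by apply: le_trans p_ge0; rewrite lee_fin mulr_le0_ge0 ?powR_ge0.
  apply: le_trans lo; rewrite lee_fin; apply: ler_pM; rewrite ?powR_ge0 //.
  - by rewrite ltW.
  - by rewrite lerD2l lerN2.
  - by rewrite ler_powR // lerD2l lerN2.
apply: le_trans hi _; rewrite lee_fin; apply: ler_pM; rewrite ?powR_ge0 //.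
- by rewrite addr_ge0.
- by rewrite lerD2l.
- by rewrite ler_powR // lerD2l.
Qed.

(** The lower bound is nonpositive and the upper one at least 1. This guarantees an admissible error
    for [error_rate_exists]. *)
Lemma late_bounds_trivial (e : R) : (p <= 1)%E -> 1 <= e -> l%:R * alpha <= e ->
  late_bounds N l alpha e p.
Proof.
move=> p1 e1 le; split.
  by apply: le_trans p_ge0; rewrite lee_fin mulr_le0_ge0 ?powR_ge0 // subr_le0.
apply: le_trans p1 _; rewrite lee_fin -[leLHS]mulr1; apply: ler_pM => //.
  by rewrite lerDl (le_trans ler01).
by rewrite -[leLHS](powRr0 N%:R) ler_powR // addrC subr_ge0.
Qed.

End LateBounds.

Lemma late_bounds0 (R : realType) (N : nat) (alpha e : R) :
  (0 < N)%N -> 0 <= e -> late_bounds N 0 alpha e 1%E.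
Proof.
move=> N0 e0; have N1 : 1 <= N%:R :> R by rewrite ler1n.
split; rewrite lee_fin mul0r oppr0.
  rewrite -[leRHS]mulr1; have [h|h] := leP 0 (1 - e).
    apply: ler_pM; rewrite ?powR_ge0 // ?gerBl //.
    by rewrite -[leRHS](powRr0 N%:R) ler_powR // add0r oppr_le0.
  by rewrite mulr1 (le_trans _ ler01) // mulr_le0_ge0 ?powR_ge0 // ltW.
rewrite -[leLHS]mulr1; apply: ler_pM => //; first by rewrite lerDl.
by rewrite -[leLHS](powRr0 N%:R) ler_powR // add0r.
Qed.

(* The best admissible error, up to an additive slack [u] that makes it
   admissible. *)
Lemma error_rate_exists (R : realType) (T : Type) (good : T -> R -> Prop)
    (u : T -> R) : exists delta : T -> R,
  (forall t, 0 <= u t -> 0 <= delta t) /\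
  (forall t, 0 < u t -> (exists2 e, 0 <= e & good t e) ->
     exists e, [/\ 0 <= e, e <= delta t & good t e]) /\
  (forall t e, 0 <= e -> good t e -> delta t <= e + u t).
Proof.
pose E t := [set e | 0 <= e /\ good t e].
have lbE t : has_lbound (E t) by exists 0 => e [].
exists (fun t => inf (E t) + u t); split; [|split] => t.
- move=> ut; rewrite addr_ge0 //; have [->|/set0P E0] := eqVneq (E t) set0.
    by rewrite inf0.
  by apply: lb_le_inf => // e [].
- move=> ut [e e0 ge]; have hE : has_inf (E t) by split=> //; exists e.
  by have [e' [e'0 ge'] lt'] := inf_adherent ut hE; exists e'; rewrite (ltW lt').
- by move=> e e0 ge; rewrite lerD2r ge_inf.
Qed.

Section Main.
Variables (R : realType) (G : nat -> sgraph).
Hypothesis Gconn : forall n, connected_graph (G n).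
Hypothesis Gtrans : forall n, vertex_transitive (G n).
Hypothesis GTA : transience_assumption R G.
Variables (d : nat -> measure_display) (Omega : forall n, measurableType (d n)).
Variables (P : forall n, probability (Omega n) R).
Variables (X : forall n, nat -> Omega n -> G n).
Hypothesis XP : forall n, stationary_lazy_walk (P n) (@X n).
Variables (alpha : R) (l : nat).
Hypothesis alpha01 : 0 < alpha < 1.

Local Notation late_prob n x :=
  (P n [set w | forall i : 'I_l, late_points (P n) (@X n) alpha w (x i)]).

Let G_gt0 n : (0 < #|G n|)%N. Proof. by case: (Gconn n). Qed.

Lemma late_prob_ge0 n x : (0 <= late_prob n x)%E.
Proof. exact: measure_ge0. Qed.

Lemma late_prob_le1 n x : (late_prob n x <= 1)%E.
Proof.
by apply: probability_le1; apply: late_event_measurable; case: (XP n).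
Qed.

Lemma late_bounds_l0 n x e : l = 0%N -> 0 <= e ->
  late_bounds #|G n| l alpha e (late_prob n x).
Proof.
move=> l0 e0; rewrite (_ : [set _ | _] = setT).
  by rewrite probability_setT [in late_bounds _ _]l0; exact: late_bounds0.
by apply/seteqP; split=> w //= _ i; have := ltn_ord i; rewrite [X in (_ < X)%N]l0.
Qed.

Lemma card_large (B : R) : \forall n \near \oo, B <= #|G n|%:R.
Proof.
case: GTA => _ /cvgnyPge h _ _ _; have := h (Num.truncn B).+1.
apply: filterS => n Bn; apply: le_trans (ltW (truncnS_gt B)) _.
by rewrite ler_nat.
Qed.

Lemma Tmix_small (kappa : R) : 0 < kappa ->
  \forall n \near \oo, (Tmix R (G n))%:R <= kappa * #|G n|%:R.
Proof.
(* The mixing condition is used at exponent 1, the degree being at least one. *)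
move=> k0; case: GTA => _ _ _ _ /(_ 1 ltr01)/eqoP/(_ _ k0) h.
have h2 := card_large 2; near=> n.
have n2 : 2 <= #|G n|%:R :> R by near: n.
have : `|(Tmix R (G n))%:R * (maxdeg (G n))%:R `^ 1 : R^o| <=
   kappa * `|#|G n|%:R : R^o| by near: n.
rewrite powRr1 ?ler0n // -natrM !ger0_norm ?ler0n //.
apply: le_trans; rewrite ler_nat; apply: leq_pmulr.
have /card_gt0P[y _] := G_gt0 n; rewrite (maxdegE (@Gtrans n) y).
by apply: (deg_gt0 (Gconn n)); rewrite -(ltr_nat R) (lt_le_trans _ n2) // ltr_nat.
Unshelve. all: by end_near.
Qed.

Lemma separated_near (kappa r : R) : 0 < kappa -> 0 < r ->
  \forall n \near \oo, exists S : {set G n},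
    (forall x y, x \in S -> y \in S -> x != y -> r < (dist x y)%:R) /\
    (1 - kappa) * ln #|G n|%:R <= ln #|S|%:R.
Proof.
move=> k0 r0; case: GTA => _ _ _ /(_ r r0 kappa k0) h _; move: h.
apply: filterS => n h; apply: separated_set_exists => //; exact: ltW.
Qed.

Lemma late_bounds_far (eps : R) : 0 < eps -> exists2 r0 : R, 0 < r0 &
  forall r : R, r0 <= r -> forall x : (forall n, 'I_l -> G n),
    (\forall n \near \oo, forall i j : 'I_l, i != j ->
       r <= (dist (x n i) (x n j))%:R) ->
    \forall n \near \oo, late_bounds #|G n| l alpha eps (late_prob n (x n)).
Proof.
move=> eps0; have [l0|l_gt0] := posnP l.
  exists 1 => // r _ x _; apply: nearW => n; by apply: late_bounds_l0 => //; exact: ltW.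
have [kappa [B [k0 H]]] := late_bounds_of_graph alpha01 eps0 l_gt0.
have [[rho [rhoP rhoG]] _ _ _ _] := GTA.
have [_ rho_mono /(_ 0 (lexx 0)) rho0] := rhoP.
have [r1 r1_gt0 r1P] : exists2 r1 : R, 0 < r1 & rho r1 0 <= kappa.
  have /cvgr0Pnorm_le/(_ _ k0) h := rho0.
  have [r1 [h1 h2]] := filter_ex (filterI h (nbhs_pinfty_gt (num_real (0 : R)))).
  by exists r1 => //; exact: le_trans (ler_norm _) h1.
(* At separation [2 * r1] at most one point of the family is within [r1] of a given vertex; it is
   the exempt one. *)
exists (2 * r1); first by rewrite mulr_gt0.
move=> r rr x xsep.
have hB := card_large B; have hT := Tmix_small k0.
have hS := separated_near k0 r1_gt0.
have r_gt0 : 0 < r by apply: lt_le_trans rr; rewrite mulr_gt0.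
near=> n.
have sep : forall i j : 'I_l, i != j -> r <= (dist (x n i) (x n j))%:R.
  by near: n.
have [S [Ssep lnS]] : exists S : {set G n},
    (forall x y, x \in S -> y \in S -> x != y -> r1 < (dist x y)%:R) /\
    (1 - kappa) * ln #|G n|%:R <= ln #|S|%:R by near: n.
have green_far (u v : G n) : r1 <= (dist u v)%:R -> green R u v <= kappa.
  move=> uv; apply: le_trans r1P.
  exact: (green_le_rho (Gconn n) rhoP (rhoG n) (ltW r1_gt0) uv).
apply: (H _ _ _ _ _ _ S) => //; try by near: n.
- move=> i j xij; apply/eqP/negPn/negP => /sep.
  by rewrite xij distxx // leNgt r_gt0.
- move=> u.
  have [[i0 ui0]|no] := pselect (exists i, (dist u (x n i))%:R < r1).
    exists (x n i0) => i ii0; apply: green_far.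
    have /sep : i0 != i by apply: contraNneq ii0 => ->.
    have : (dist (x n i0) (x n i))%:R <=
        (dist u (x n i0))%:R + (dist u (x n i))%:R :> R.
      by rewrite -natrD ler_nat (dist_sym (Gconn n) u (x n i0)) dist_triangle.
    by move: ui0 rr; lra.
  exists u => i _; apply: green_far; rewrite leNgt; apply/negP => h.
  by apply: no; exists i.
- by move=> u v uS vS uv; apply/green_far/ltW/Ssep.
Unshelve. all: by end_near.
Qed.

(** The exempt vertex is [u] itself, by [green_le_deg]. The threshold on [n] is uniform over
    injective families, so the error can depend on [n] alone. *)
Lemma late_bounds_distinct (eps : R) : 0 < eps ->
  maxdeg (G n) @[n --> \oo] --> \oo ->
  \forall n \near \oo, forall x : 'I_l -> G n, injective x ->
    late_bounds #|G n| l alpha eps (late_prob n x).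
Proof.
move=> eps0 /cvgnyPge degG; have [l0|l_gt0] := posnP l.
  by apply: nearW => n x _; apply: late_bounds_l0 => //; exact: ltW.
have [kappa [B [k0 H]]] := late_bounds_of_graph alpha01 eps0 l_gt0.
have [[rho [rhoP rhoG]] _ _ _ _] := GTA.
have [_ rho_mono /(_ 0 (lexx 0)) rho0] := rhoP.
have [r1 r1_gt0 r1P] : exists2 r1 : R, 0 < r1 & rho r1 0 <= kappa.
  have /cvgr0Pnorm_le/(_ _ k0) h := rho0.
  have [r1 [h1 h2]] := filter_ex (filterI h (nbhs_pinfty_gt (num_real (0 : R)))).
  by exists r1 => //; exact: le_trans (ler_norm _) h1.
have hB := card_large B; have h2 := card_large 2; have hT := Tmix_small k0.
have hS := separated_near k0 r1_gt0.
pose C := rho 0 0 + rho 0 1 + rho 0 2.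
have hD := degG (Num.truncn (C / kappa)).+1.
near=> n.
have [S [Ssep lnS]] : exists S : {set G n},
    (forall x y : G n, x \in S -> y \in S -> x != y -> r1 < (dist x y)%:R) /\
    (1 - kappa) * ln #|G n|%:R <= ln #|S|%:R by near: n.
have n1 : (1 < #|G n|)%N.
  by rewrite -(ltr_nat R); apply: lt_le_trans (_ : 2 <= _);
    [rewrite ltr1n|near: n].
have D : C / kappa <= (maxdeg (G n))%:R.
  apply: le_trans (ltW (truncnS_gt _)) _; rewrite ler_nat; near: n; exact: hD.
have [u0 _] : exists u : G n, true.
  by have /card_gt0P[u] := G_gt0 n; exists u.
have D0 : 0 < (maxdeg (G n))%:R :> R.
  by rewrite ltr0n (maxdegE (@Gtrans n) u0); exact: (deg_gt0 (Gconn n)).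
move=> x xinj; apply: (H _ _ _ _ _ _ S) => //; try by near: n.
- move=> u; exists u => i xu.
  have ux : u != x i by rewrite eq_sym.
  apply: le_trans (green_le_deg (Gconn n) (@Gtrans n) rhoP (rhoG n) n1 ux) _.
  by rewrite ler_pdivrMr // mulrC -ler_pdivrMr.
- move=> u v uS vS uv; apply: le_trans r1P.
  exact: (green_le_rho (Gconn n) rhoP (rhoG n) (ltW r1_gt0) (ltW (Ssep _ _ uS vS uv))).
Unshelve. all: by end_near.
Qed.

Lemma late_bounds_max n x :
  late_bounds #|G n| l alpha (Num.max 1 (l%:R * alpha)) (late_prob n x).
Proof.
apply: late_bounds_trivial.
- exact: G_gt0.
- exact: late_prob_ge0.
- exact: late_prob_le1.
- by rewrite le_max lexx.
- by rewrite le_max lexx orbT.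
Qed.

Lemma far_error_rate : exists delta : R -> R,
  [/\ forall r, 0 < r -> 0 <= delta r,
      delta r @[r --> +oo] --> (0 : R)
    & forall r, 0 < r -> forall x : (forall n, 'I_l -> G n),
        (\forall n \near \oo, forall i j : 'I_l, i != j ->
           r <= (dist (x n i) (x n j))%:R) ->
        \forall n \near \oo,
          late_bounds #|G n| l alpha (delta r) (late_prob n (x n))].
Proof.
pose good (r e : R) := forall x : (forall n, 'I_l -> G n),
  (\forall n \near \oo, forall i j : 'I_l, i != j ->
     r <= (dist (x n i) (x n j))%:R) ->
  \forall n \near \oo, late_bounds #|G n| l alpha e (late_prob n (x n)).
(* The slack [1 / r] is positive and vanishes as [r] grows. *)
have [delta [d0 [dgood dle]]] := error_rate_exists good GRing.inv.
exists delta; split.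
- by move=> r r0; apply: d0; rewrite invr_ge0 ltW.
- apply/cvgr0Pnorm_le => eps eps0.
  have e2 : 0 < eps / 2 by rewrite divr_gt0.
  have [r0 r0_gt0 r0P] := late_bounds_far e2.
  near=> r.
  have rr0 : r0 <= r by near: r; apply: nbhs_pinfty_ge; exact: num_real.
  have re : (eps / 2)^-1 <= r by near: r; apply: nbhs_pinfty_ge; exact: num_real.
  have r_gt0 : 0 < r by exact: lt_le_trans rr0.
  have ri : r^-1 <= eps / 2.
    by rewrite -[leRHS]invrK lef_pV2 ?posrE ?invr_gt0.
  rewrite ger0_norm; last by apply: d0; rewrite invr_ge0 ltW.
  have := dle r _ (ltW e2) (r0P r rr0); lra.
- move=> r r0 x xsep.
  have ri : 0 < r^-1 by rewrite invr_gt0.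
  have [|e [e0 ed eg]] := dgood r ri.
    exists (Num.max 1 (l%:R * alpha)); first by rewrite le_max ler01.
    by move=> y _; apply: nearW => n; exact: late_bounds_max.
  have := eg x xsep; apply: filterS => n.
  by apply: late_bounds_le => //; exact: late_prob_ge0.
Unshelve. all: by end_near.
Qed.

Lemma distinct_error_rate : maxdeg (G n) @[n --> \oo] --> \oo ->
  exists delta : nat -> R,
  [/\ forall n, 0 <= delta n,
      delta n @[n --> \oo] --> (0 : R)
    & forall x : (forall n, 'I_l -> G n),
        (\forall n \near \oo, forall i j : 'I_l, i != j -> x n i <> x n j) ->
        \forall n \near \oo,
          late_bounds #|G n| l alpha (delta n) (late_prob n (x n))].
Proof.
move=> degG.
(* Here admissibility concerns a single graph, so the best error is taken for each [n]
   separately. *)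
pose good n (e : R) := forall x : 'I_l -> G n, injective x ->
  late_bounds #|G n| l alpha e (late_prob n x).
have [delta [d0 [dgood dle]]] := error_rate_exists good (fun n => n.+1%:R^-1).
have u0 n : 0 < n.+1%:R^-1 :> R by rewrite invr_gt0.
exists delta; split.
- by move=> n; apply: d0; exact: ltW.
- apply/cvgr0Pnorm_le => eps eps0.
  have e2 : 0 < eps / 2 by rewrite divr_gt0.
  have hg := late_bounds_distinct e2 degG.
  have hi := near_infty_natSinv_lt (PosNum e2).
  near=> n.
  have gn : good n (eps / 2) by near: n.
  have un : n.+1%:R^-1 < eps / 2 by near: n.
  rewrite ger0_norm; last by apply: d0; exact: ltW.
  have h : delta n <= eps / 2 + n.+1%:R^-1 := dle n _ (ltW e2) gn.
  by move: un h; move: (n.+1%:R^-1) (delta n) => v w; lra.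
- move=> x; apply: filterS => n xn.
  have [|e [e0 ed eg]] := dgood n (u0 n).
    exists (Num.max 1 (l%:R * alpha)); first by rewrite le_max ler01.
    by move=> y _; exact: late_bounds_max.
  apply: (late_bounds_le (G_gt0 n) (@late_prob_ge0 n (x n)) e0 ed).
  by apply: eg => i j xij; apply/eqP/negPn/negP => /xn.
Unshelve. all: by end_near.
Qed.

End Main.

Theorem theorem1p6 (R : realType) (G : nat -> sgraph)
    (Gconn : forall n, connected_graph (G n))
    (Gtrans : forall n, vertex_transitive (G n))
    (GTA : transience_assumption R G)
    (d : nat -> measure_display) (Omega : forall n, measurableType (d n))
    (P : forall n, probability (Omega n) R)
    (X : forall n, nat -> Omega n -> G n)
    (XP : forall n, stationary_lazy_walk (P n) (X n))
    (alpha : R) (alpha01 : 0 < alpha < 1) (l : nat) :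
  (exists delta : R -> R,
    [/\ forall r, 0 < r -> 0 <= delta r,
        delta r @[r --> +oo] --> (0 : R)
      & forall r, 0 < r -> forall x : (forall n, 'I_l -> G n),
          (\forall n \near \oo, forall i j : 'I_l, i != j ->
             r <= (dist (x n i) (x n j))%:R) ->
          \forall n \near \oo,
            late_bounds #|G n| l alpha (delta r)
              (P n [set w | forall i : 'I_l,
                 late_points (P n) (X n) alpha w (x n i)])]) /\
  (maxdeg (G n) @[n --> \oo] --> \oo ->
   exists delta : nat -> R,
    [/\ forall n, 0 <= delta n,
        delta n @[n --> \oo] --> (0 : R)
      & forall x : (forall n, 'I_l -> G n),
          (\forall n \near \oo, forall i j : 'I_l, i != j ->
             x n i <> x n j) ->
          \forall n \near \oo,
            late_bounds #|G n| l alpha (delta n)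
              (P n [set w | forall i : 'I_l,
                 late_points (P n) (X n) alpha w (x n i)])]).
Proof.
split; first exact (far_error_rate Gconn Gtrans GTA XP l alpha01).
exact (distinct_error_rate Gconn Gtrans GTA XP l alpha01).
Qed.
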